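(* Let $G$ be a normally monomial $5$-group of maximal class. Then the set $\mathrm{cd}(G)$ of degrees of irreducible complex characters of $G$ is one of $\{1,5\}$, $\{1,5,5^2\}$, $\{1,5,5^3\}$ or $\{1,5,5^2,5^3\}$. Moreover, each of these four sets occurs as $\mathrm{cd}(G)$ for some normally monomial $5$-group $G$ of maximal class.
   Context: All groups are finite. A group $G$ is normally monomial if every irreducible complex character of $G$ is induced from a linear character of some normal subgroup of $G$. For a prime $p$, a $p$-group of order $p^n\ge p^3$ is of maximal class if its nilpotency class is $n-1$. $\mathrm{cd}(G)=\{\chi(1) : \chi\in\mathrm{Irr}(G)\}$. *)

(* Defs.v *)
From HB Require Import structures.
From mathcomp Require Import all_boot all_order all_algebra all_fingroup.
From mathcomp Require Import all_solvable all_field all_character.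

Set Implicit Arguments.
Unset Strict Implicit.
Unset Printing Implicit Defensive.

Import GroupScope GRing.Theory.
Local Open Scope ring_scope.

Definition normally_monomial (gT : finGroupType) (G : {group gT}) : Prop :=
  forall i : Iirr G, exists (N : {group gT}) (lambda : 'CF(N)),
    [/\ N <| G, lambda \is a linear_char & 'chi_i = 'Ind[G, N] lambda].

Definition maximal_class (p : nat) (gT : finGroupType) (G : {group gT}) : Prop :=
  prime p /\
  exists n : nat, [/\ (3 <= n)%N, #|G| = (p ^ n)%N & nil_class G = n.-1].

(* The set of degrees, as a list with possible repetitions: only its
   extension, compared with =i, is meaningful. MathComp's irreducible
   characters are valued in algC; they are the complex ones, since every
   complex character of a finite group has algebraic integer values and is
   afforded over the algebraic numbers. *)
Definition cd (gT : finGroupType) (G : {group gT}) : seq algC :=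
  [seq 'chi_i 1%g | i : Iirr G].

(* Main.v *)
(* Let L i be the terms of the lower central series. If G has order 5^n, every
   normal subgroup of index at least 5^2 is some L i, and the kernel of a
   nonlinear irreducible character is some L m with m > 2; when G is normally
   monomial all characters with that kernel have the same degree 5^k, with
   2 k < m, and are induced from a normal subgroup B of index 5^k with
   B' <= L m. This forces [L i, L i] <= L (2 i + 2), and a maximal subgroup A
   with A' <= L 4, so commutators of terms drop by one more step than expected
   (A has positive degree of commutativity). Since fifth powers in A move down
   four steps, one shows by induction on m that [L 3, L 3] <= L m: this could only
   break down if an element outside L 3 fixed a linear character of L 3 lying
   under one with kernel L m, but in a normally monomial group the latter is then
   induced from L 3. Hence L 3 is abelian, of index 5^3, and bounds the degrees.

   For the examples, let O = Z[zeta] / 25 with zeta a primitive fifth root of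
   unity acting by multiplication, pi = zeta - 1; O is deformed by a bilinear
   zeta-equivariant cocycle with values in pi^6 O, and extended by <zeta>. *)
Require Import Defs.
From HB Require Import structures.
From mathcomp Require Import all_boot all_order all_algebra all_fingroup.
From mathcomp Require Import all_solvable all_field all_character.
From mathcomp Require Import zify ring.

Set Implicit Arguments.
Unset Strict Implicit.
Unset Printing Implicit Defensive.

Import GRing.Theory Num.Theory.
Local Open Scope ring_scope.

(** * Characters and lower central series *)

(** The three subgroups lemma carries a bound on one commutator of terms to its neighbours, but it
    cannot start an improvement; fifth powers do. Modulo 5 the sum of the first five powers of 1 + X
    is X^4, so the fifth power of a generator of a term agrees, up to inversion, with its fourfold
    commutator with an outer element [s]. In particular the fifth power of a generator [g] of [A]
    over L 2 generates the fifth term over the sixth and commutes with [g]; this bounds the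
    commutators of [A] with the fifth term. The induction carries [L 2, L 2] <= L m and [L 3, L 3]
    <= L (m + 1) together, up to m = n - 1. If the first bound could not be improved, 5^3 would be
    the only degree with kernel L (m + 2), and this is what ties that level to L 3. In the examples
    25 is a unit times pi^8, so O / 25 has eight layers and the groups have order 5^9. As pi^4 O = 5
    O, a bilinear map into pi^6 O vanishes on pi^4 O, so its composites vanish. Only the kernels L 8
    and L 9 can then give degrees above 5, and the set of degrees is decided there. *)

Section ThreeSubgroups.
Local Open Scope group_scope.
Variables (gT : finGroupType) (G N : {group gT}).
Hypothesis nNG : N <| G.

Lemma three_subgroup_mod (X Y Z : {group gT}) :
    X \subset G -> Y \subset G -> Z \subset G ->
    [~: X, Y, Z] \subset N -> [~: Y, Z, X] \subset N ->
  [~: Z, X, Y] \subset N.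
Proof.
move=> sX sY sZ XYZ YZX; have nN := normal_norm nNG.
have [[nX nY] nZ] := (subset_trans sX nN, subset_trans sY nN, subset_trans sZ nN).
have quo (A B C : {group gT}) : A \subset 'N(N) -> B \subset 'N(N) ->
    C \subset 'N(N) ->
    ([~: A, B, C] \subset N) = ([~: A / N, B / N, C / N] == 1).
  move=> nA nB nC.
  rewrite -!morphimR ?quotientE //; last by rewrite comm_subG.
  by rewrite -quotientE -subG1 quotient_sub1 // !comm_subG.
rewrite (quo Z X Y) //; apply/eqP; apply: three_subgroup; apply/eqP.
  by rewrite -(quo X Y Z).
by rewrite -(quo Y Z X).
Qed.
End ThreeSubgroups.

Section PrimeIndex.
Local Open Scope nat_scope.
Local Open Scope group_scope.

(** The index of [M :&: H] in [M] divides the prime [#|M : N|], and [x] prevents equality. *)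
Lemma prime_index_gen (gT : finGroupType) (M N H : {group gT}) x :
    N \subset M -> prime #|M : N| -> x \in M -> x \notin N -> x \in H ->
  N \subset H -> M \subset H.
Proof.
move=> sNM pr xM nxN xH sNH.
apply/setIidPl/eqP; rewrite eqEsubset subsetIl -indexg_eq1 /=.
have sub : N \subset M :&: H by rewrite subsetI sNM.
have ip := Lagrange_index (subsetIl M H) sub.
have /(primeP pr).2/orP[// | /eqP eqp] : #|M : M :&: H| %| #|M : N|.
  by rewrite -ip dvdn_mulr.
move/eqP: ip; rewrite eqp -{2}(muln1 #|M : N|) eqn_pmul2l ?prime_gt0 // indexg_eq1.
by move/subsetP/(_ x); rewrite inE xM xH (negPf nxN) => /(_ isT).
Qed.

End PrimeIndex.

Section Characters.
Local Open Scope group_scope.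
Variables (gT : finGroupType) (G : {group gT}).

(** The restriction to [B] has a linear constituent; by reciprocity ['chi_i] occurs in the character
    induced from it, whose degree is the index. *)
Lemma irr1_le_index (B : {group gT}) (i : Iirr G) :
  B <| G -> B^`(1) \subset cfker 'chi_i -> 'chi_i 1 <= #|G : B|%:R :> algC.
Proof.
move=> nBG kB; have sBG := normal_sub nBG.
have [j jB] := constt_cfRes_irr B i.
have linj : 'chi_j \is a linear_char.
  rewrite lin_irr_der1; have ch := cfRes_char B (irr_char i).
  apply: subset_trans (cfker_constt ch jB).
  by rewrite cfker_Res ?irr_char // subsetI kB der_sub.
have := char1_ge_constt (cfInd_char G (irr_char j)).
rewrite -constt_Ind_Res in jB; move/(_ _ jB).
by rewrite cfInd1 // (lin_char1 linj) GRing.mulr1.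
Qed.

Lemma exists_irr_separating (C N : {group gT}) :
  N <| G -> C \subset G -> ~~ (C \subset N) ->
  exists i : Iirr G, N \subset cfker 'chi_i /\ ~~ (C \subset cfker 'chi_i).
Proof.
move=> nNG sCG nsC.
have [/existsP[i /andP[]] | /existsPn all] :=
  boolP [exists i : Iirr G, (N \subset cfker 'chi_i) && ~~ (C \subset cfker 'chi_i)].
  by exists i.
case/negP: nsC; rewrite -(quotient_sub1 (subset_trans sCG (normal_norm nNG))).
rewrite -(TI_cfker_irr (G / N)); apply/bigcapsP=> i _.
have:= all (mod_Iirr i); rewrite mod_IirrE // cfker_mod //= negbK => sCk.
rewrite sub_quotient_pre ?(subset_trans sCG (normal_norm nNG)) // (subset_trans sCk) //.
by rewrite cfker_morph ?normal_norm // subsetIr.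
Qed.

(** By the Clifford correspondence ['chi_i] is induced from some ['chi_k] of the inertia group [T].
    The degree makes ['chi_k] all of the character induced from ['chi_j] to [T]; so that character
    has norm 1, while invariance of ['chi_j] gives it norm [#|T : B|]. *)
Lemma Inertia_full_degree (B : {group gT}) (j : Iirr B) (i : Iirr G) :
    B <| G -> 'chi_j \is a linear_char -> i \in irr_constt ('Ind[G] 'chi_j) ->
    'chi_i 1 = #|G : B|%:R -> 'I_G['chi_j] \subset B.
Proof.
move=> nBG linj ij deg; have sBG := normal_sub nBG.
set T := 'I_G['chi_j]%G; have nBT : B <| T := normal_Inertia _ sBG.
have sTG : T \subset G by apply: subsetIl.
have [irrT _ imT _ _] := constt_Inertia_bijection j nBG.
have /imsetP[k kA ik] : i \in [set Ind_Iirr G x | x in irr_constt ('Ind[T] 'chi_j)].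
  by rewrite imT.
have Di : 'chi_i = 'Ind[G] 'chi_k by rewrite ik /Ind_Iirr cfIirrE // irrT.
have chI := cfInd_char T (irr_char j).
have deg_k : 'chi_k 1%g = 'Ind[T] 'chi_j 1%g.
  apply: (GRing.mulfI (neq0CiG G T)).
  rewrite -cfInd1 // -Di deg cfInd1 ?normal_sub // (lin_char1 linj) GRing.mulr1.
  by rewrite -GRing.natrM Lagrange_index // normal_sub.
have Dk : 'Ind[T] 'chi_j = 'chi_k.
  have [chi Nchi Dchi] := constt_charP k chI kA.
  have /eqP : chi 1%g = 0%R.
    by move/eqP: deg_k; rewrite Dchi cfunE eq_sym -subr_eq0 addrAC subrr add0r => /eqP.
  by rewrite (char1_eq0 Nchi) Dchi => /eqP->; rewrite addr0.
have: '['Ind[T] 'chi_j, 'Ind[T] 'chi_j] = 1%R by rewrite Dk cfnorm_irr.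
have invj : T \subset 'I['chi_j] by apply: subsetIr.
rewrite -cfdot_Res_l cfRes_Ind_invariant // cfdotZl cfnorm_irr GRing.mulr1 => /eqP.
by rewrite pnatr_eq1 indexg_eq1.
Qed.

End Characters.

(** * The lower central series of a p-group of maximal class *)

Section MaximalClass.
Local Open Scope nat_scope.
Local Open Scope group_scope.
Variables (p : nat) (gT : finGroupType) (G : {group gT}) (n : nat).
Hypotheses (p_pr : prime p) (n_ge3 : 2 < n) (oG : #|G| = (p ^ n)%N).
Hypothesis clG : nil_class G = n.-1.

Local Notation L i := 'L_i(G).

Lemma mc_pgroup : p.-group G.
Proof. by rewrite /pgroup oG pnatX pnat_id. Qed.
Let pG := mc_pgroup.

Lemma mc_nilpotent : nilpotent G. Proof. exact: pgroup_nil pG. Qed.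
Let nilG := mc_nilpotent.

Lemma mc_lcn_triv i : n <= i -> L i = 1.
Proof.
move=> le_ni; apply/trivgP; apply: subset_trans (lcn_sub_leq G le_ni) _.
have/(lcn_nil_classP _ nilG) : nil_class G <= n.-1 by rewrite clG.
by rewrite (ltn_predK n_ge3) => ->.
Qed.

Lemma mc_lcn_proper i : 0 < i < n -> L i.+1 \proper L i.
Proof.
case: i => // i /andP[_ lt_in]; rewrite properEneq lcn_subS andbT.
apply/eqP=> eqL; have Lc j : L (j + i.+1) = L i.+1.
  elim: j => // -[_|j IHj]; first by rewrite add1n.
  by rewrite !addSn lcnSn -addSn IHj -lcnSn eqL.
have: L i.+1 = 1.
  by have <- := Lc (n - i.+1)%N; rewrite subnK 1?ltnW // mc_lcn_triv.
move/(lcn_nil_classP _ nilG); rewrite clG => le_ni.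
by move: lt_in; rewrite -(ltn_predK n_ge3) ltnS ltnNge le_ni.
Qed.

Lemma mc_card_lcn i : 1 < i <= n -> #|L i| = (p ^ (n - i))%N.
Proof.
have pL j : p.-group (L j) by apply: pgroupS (lcn_sub _ _) pG.
have logS j : 0 < j < n -> logn p #|L j.+1| < logn p #|L j|.
  by move=> /mc_lcn_proper; apply: properG_ltn_log (pL _).
(* Otherwise the abelianization has order at most [p], so [G] is cyclic, of class at most 1. With
   the strict descent from [L 2] to [L n] this leaves no slack in the orders. *)
have log2 : logn p #|L 2| <= n - 2.
  rewrite leqNgt; apply/negP=> lt2.
  have iG : logn p #|G : G^`(1)| <= 1.
    rewrite -divgS ?der_sub // logn_div ?cardSg ?der_sub // oG pfactorK //.
    have := lt2; rewrite lcn2; move: (logn p _) => k; lia.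
  have cycG : cyclic G.
    apply: cyclic_nilpotent_quo_der1_cyclic => //.
    have := pnat_dvd (dvdn_indexg G (G^`(1))%G) (mc_pgroup : p.-nat #|G|).
    move/part_pnat_id; rewrite p_part -card_quotient ?der_norm // => cQ.
    move: iG; rewrite -card_quotient ?der_norm // in cQ *.
    case: (logn _ _) cQ => [|[|//]] cQ _.
      by rewrite (card1_trivg (esym cQ)) cyclic1.
    by rewrite prime_cyclic // -cQ.
  by have:= cyclic_abelian cycG; rewrite -nil_class1 clG leqNgt -ltnS prednK ?n_ge3 // ltnW // ltnW.
pose a i := logn p #|L i|; have {}log2 : a 2 <= n - 2 := log2.
have {logS} aS j : 0 < j < n -> a j.+1 < a j := @logS j.
move=> /andP[i2 le_in]; rewrite (card_pgroup (pL i)); congr (_ ^ _)%N.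
suffices: a i = n - i by [].
apply/eqP; rewrite eqn_leq; apply/andP; split.
  elim: i i2 le_in => // i IHi i1 lt_in.
  have [-> // | ne_i1] := eqVneq i 1%N.
  have i2 : 1 < i by rewrite ltn_neqAle eq_sym ne_i1.
  by have := aS i; have := IHi i2 (ltnW lt_in); lia.
have [j] := ubnPeq (n - i)%N; elim: j i i2 le_in => [|j IHj] i i2 le_in; first lia.
move=> le_j; have [lt_in | ] := ltnP i n; last lia.
have := IHj i.+1; have := aS i; lia.
Qed.

(** A group of order [p ^ k] has class at most [maxn 1 k.-1]. *)
Lemma mc_normal_index (N : {group gT}) k :
  N <| G -> #|G : N| = (p ^ k)%N -> L (maxn 2 k) \subset N.
Proof.
move=> nNG iN; have nNG' := normal_norm nNG.
rewrite -quotient_sub1 ?(subset_trans (lcn_sub _ _)) // quotientE.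
rewrite morphim_lcn // -quotientE.
have pQ : p.-group (G / N) := quotient_pgroup _ pG.
have := nil_class_pgroup pQ; rewrite card_quotient // iN pfactorK // => cl.
have -> : maxn 2 k = (maxn 1 k.-1).+1 by lia.
by have/(lcn_nil_classP _ (pgroup_nil pQ)) -> := cl.
Qed.

Lemma mc_normal_eq (N : {group gT}) k :
  N <| G -> #|G : N| = (p ^ k)%N -> 1 < k -> N :=: L k.
Proof.
move=> nNG iN k2; have := mc_normal_index nNG iN; rewrite (maxn_idPr k2) => sLN.
have le_kn : k <= n.
  by rewrite -(leq_exp2l _ _ (prime_gt1 p_pr)) -iN -oG dvdn_leq // dvdn_indexg.
apply/esym/eqP; rewrite eqEcard sLN mc_card_lcn ?k2 //.
rewrite -(leq_pmul2r (indexg_gt0 G N)) Lagrange ?normal_sub // iN.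
by rewrite -expnD subnK // oG leqnn.
Qed.

Lemma mc_normalP (N : {group gT}) : N <| G ->
  L 2 \subset N \/ exists2 k, 1 < k <= n & N :=: L k.
Proof.
move=> nNG; have [k iN] : exists k, #|G : N| = (p ^ k)%N.
  exists (logn p #|G : N|); rewrite -p_part part_pnat_id //.
  exact: pnat_dvd (dvdn_indexg G N) pG.
have [k1 | k2] := leqP k 1.
  by left; have := mc_normal_index nNG iN; rewrite (maxn_idPl _) // ltnW.
right; exists k; last exact: mc_normal_eq.
by rewrite k2 -(leq_exp2l _ _ (prime_gt1 p_pr)) -iN -oG dvdn_leq // dvdn_indexg.
Qed.

Lemma mc_lcn_subE i j : 1 < j < n -> (L j \subset L i) = (i <= j).
Proof.
move=> /andP[j2 jn]; apply/idP/idP; last exact: lcn_sub_leq.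
apply: contraTT; rewrite -ltnNge => lt_ji; have i2 := ltn_trans j2 lt_ji.
apply/negP=> sub; have := subset_leq_card (subset_trans sub (lcn_sub_leq G lt_ji)).
rewrite (@mc_card_lcn j) ?j2 ?(ltnW jn) // (@mc_card_lcn j.+1) ?ltnS ?(ltnW j2) //.
by rewrite leq_exp2l ?prime_gt1 // leqNgt ltn_sub2l.
Qed.

Lemma mc_lcn_index i : 1 < i < n -> #|L i : L i.+1| = p.
Proof.
case/andP=> i2 lt_in.
have oi : #|L i| = (p ^ (n - i))%N by apply: mc_card_lcn; rewrite i2 ltnW.
have oS : #|L i.+1| = (p ^ (n - i.+1))%N by apply: mc_card_lcn; rewrite lt_in ltnS ltnW.
apply/eqP; rewrite -(eqn_pmul2l (cardG_gt0 (L i.+1))) Lagrange ?lcn_subS //= oi oS.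
by rewrite -expnSr subnSK.
Qed.

(** Lifts a bound on [[~: N, G]] to [N] itself: [N] is some [L k], and commutation with [G] moves it
    by exactly one term as long as the terms are distinct. *)
Lemma mc_upper (N : {group gT}) i :
  N <| G -> N \subset L 2 -> [~: N, G] \subset L i.+1 -> i < n -> N \subset L i.
Proof.
move=> nNG sN2 + lt_in.
have [k /andP[k2 kn] DN] : exists2 k, 1 < k <= n & N :=: L k.
  have [sub2 | //] := mc_normalP nNG.
  by exists 2; [rewrite (ltnW n_ge3) | apply/eqP; rewrite eqEsubset sN2 sub2].
rewrite DN; case: k k2 kn DN => [|[|k]] // _ _ _.
have [le_ik _ | lt_ki] := leqP i k.+2; first exact: lcn_sub_leq.
by rewrite -lcnSn mc_lcn_subE; lia.
Qed.

End MaximalClass.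

(** * Kernels, degrees and inducing subgroups in a normally monomial group of maximal class *)

Section NormallyMonomial.
Local Open Scope nat_scope.
Local Open Scope group_scope.
Variables (p : nat) (gT : finGroupType) (G : {group gT}) (n : nat).
Hypotheses (p_pr : prime p) (n_ge3 : 2 < n) (oG : #|G| = (p ^ n)%N).
Hypothesis clG : nil_class G = n.-1.

Local Notation L i := 'L_i(G).
Local Notation level m i :=
  (L m \subset cfker 'chi[G]_i /\ ~~ (L m.-1 \subset cfker 'chi[G]_i)).

Lemma cfker_level m (i : Iirr G) : 2 < m <= n -> level m i -> cfker 'chi_i = L m.
Proof.
move=> /andP[m3 mn] [kLm kLm1].
have L2m : L m.-1 \subset L 2 by apply: lcn_sub_leq; lia.
have [sub | [k /andP[k2 kn] Dk]] := mc_normalP p_pr n_ge3 oG clG (cfker_normal 'chi_i).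
  by rewrite (subset_trans L2m sub) in kLm1.
apply/eqP; rewrite eqEsubset kLm andbT Dk lcn_sub_leq //.
rewrite Dk in kLm1; rewrite leqNgt; apply: contra kLm1 => lt_km.
by apply: lcn_sub_leq; lia.
Qed.

Lemma exists_level m : 2 < m <= n -> exists i, level m i.
Proof.
move=> /andP[m3 mn]; apply: exists_irr_separating (lcn_normal _ _) (lcn_sub _ _) _.
have m1n : 0 < m.-1 < n by lia.
by have := mc_lcn_proper p_pr n_ge3 oG clG m1n; rewrite (ltn_predK m3) properE => /andP[].
Qed.

Hypothesis nmG : normally_monomial G.

(** [L m.-1] is central modulo the kernel [L m], so the squared degree is at most
    [#|G : L m.-1| = p ^ m.-1], whence [k.*2 < m]. Two characters with kernel [L m] have equal
    degrees because, by [irr1_le_index], the subgroup inducing one bounds the degree of the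
    other. *)
Lemma nm_level m : 2 < m <= n ->
  exists k (B : {group gT}),
    [/\ B <| G, #|G : B| = (p ^ k)%N, k.*2 < m, B^`(1) \subset L m &
        forall i, level m i -> 'chi_i 1 = (p ^ k)%:R :> algC].
Proof.
move=> m3n; have [m3 mn] := andP m3n; have [i0 lev0] := exists_level m3n.
have kern (i : Iirr G) : level m i -> exists B : {group gT},
  [/\ B <| G, 'chi_i 1 = #|G : B|%:R :> algC & B^`(1) \subset L m].
  move=> lev; have [B [lam [nBG linl Dchi]]] := nmG i; exists B; split => //.
    by rewrite Dchi cfInd1 ?normal_sub // (lin_char1 linl) GRing.mulr1.
  have /irrP[j Dlam] := lin_char_irr linl.
  rewrite -(cfker_level m3n lev) Dchi Dlam cfker_Ind_irr ?(normal_sub nBG) // -Dlam.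
  apply: gcore_max; first exact: lin_char_der1.
  exact: char_norm_trans (der_char 1 B) (normal_norm nBG).
have [B [nBG degB derB]] := kern i0 lev0.
have [k iB] : exists k, #|G : B| = (p ^ k)%N.
  exists (logn p #|G : B|); rewrite -p_part part_pnat_id //.
  exact: pnat_dvd (dvdn_indexg G B) (mc_pgroup p_pr oG).
have ub (i : Iirr G) : level m i -> ('chi_i 1%g <= (p ^ k)%:R :> algC)%R.
  move=> lev; rewrite -iB irr1_le_index //.
  by rewrite (cfker_level m3n lev).
exists k, B; split=> //.
  have sLZ : L m.-1 \subset 'Z('chi_i0)%CF.
    have nkG := normal_norm (cfker_normal 'chi_i0).
    rewrite -(quotientSGK (subset_trans (lcn_sub _ _) nkG)); last first.
      exact: normal_sub (cfker_center_normal _).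
    rewrite cfcenter_eq_center subsetI quotientS ?lcn_sub // quotient_cents2r //=.
    by rewrite (cfker_level m3n lev0) -{2}(ltn_predK m3) lcnSnS.
  have [le_deg _] := irr1_bound i0.
  have: (p ^ k.*2 <= p ^ m.-1)%N.
    apply: (@leq_trans #|G : L m.-1|).
      apply: leq_trans (dvdn_leq _ (indexgS G sLZ)); last exact: indexg_gt0.
      move: le_deg; rewrite degB iB -natrX ler_nat -expnM.
      by rewrite -muln2.
    rewrite -divgS ?lcn_sub // oG (mc_card_lcn p_pr n_ge3 oG clG); last lia.
    by rewrite -expnB ?prime_gt0 //; [rewrite leq_exp2l ?prime_gt1 //; lia | lia].
  by rewrite leq_exp2l ?prime_gt1 //; lia.
move=> i lev; apply/eqP; rewrite Order.POrderTheory.eq_le ub //=.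
have [B' [nBG' degB' derB']] := kern i lev.
rewrite -iB -degB degB' irr1_le_index // (cfker_level m3n lev0) //.
Qed.

(** For the kernel [L k.*2.+2] the inducing subgroup has index at most [p ^ k], so it contains
    [L k]; the minimum with [n] covers the range where that term is trivial. *)
Lemma nm_lcn_der1 k : 1 < k -> [~: L k, L k] \subset L k.*2.+2.
Proof.
move=> k2; pose m := minn k.*2.+2 n.
have [|k' [B [nBG iB k'm derB _]]] := @nm_level m; first by rewrite /m; lia.
have sLB : L k \subset B.
  have := mc_normal_index p_pr n_ge3 oG clG nBG iB; apply: subset_trans.
  by apply: lcn_sub_leq; move: k'm; rewrite /m; lia.
have sub : [~: L k, L k] \subset L m by apply: subset_trans derB; apply: commgSS.
have [le_kn | lt_nk] := leqP k.*2.+2 n.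
  by rewrite /m (minn_idPl le_kn) in sub.
apply: subset_trans sub _; rewrite /m (minn_idPr (ltnW lt_nk)).
by rewrite (mc_lcn_triv p_pr n_ge3 oG clG (leqnn n)) sub1G.
Qed.

(** The kernel [L 4] leaves only index 1 or [p], and index 1 would put [L 2] inside [L 4]. *)
Lemma nm_maximal_subgroup : 3 < n ->
  exists A : {group gT}, [/\ A <| G, #|G : A| = p & A^`(1) \subset L 4].
Proof.
move=> n4; have [|k [B [nBG iB k4 derB _]]] := @nm_level 4; first by rewrite n4.
case: k => [|[|//]] in iB k4.
  move/eqP: iB; rewrite expn0 indexg_eq1 => sGB.
  have /idPn[] := subset_trans (dergS 1 sGB) derB.
  by rewrite -lcn2 (mc_lcn_subE p_pr n_ge3 oG clG) // ltnW.
by exists B; rewrite iB expn1.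
Qed.
End NormallyMonomial.

(** * Positive degree of commutativity of the series starting with [A] *)

Section DegreeOfCommutativity.
Local Open Scope nat_scope.
Local Open Scope group_scope.
Variables (p : nat) (gT : finGroupType) (G A : {group gT}) (n : nat).
Hypotheses (p_pr : prime p) (n_ge3 : 2 < n) (oG : #|G| = (p ^ n)%N).
Hypothesis clG : nil_class G = n.-1.
Hypotheses (nAG : A <| G) (iA : #|G : A| = p).

(* Only the terms with 0 < i are meaningful: the term of index 0 is again A. *)
Definition mc_term i : {group gT} := if i is _.+2 then 'L_i(G)%G else A.
Local Notation gam := mc_term.

Local Notation L i := 'L_i(G).

Lemma gam_normal i : gam i <| G.
Proof. by case: i => [|[|i]] //; apply: lcn_normal. Qed.

Lemma gam_sub i : gam i \subset G. Proof. exact: normal_sub (gam_normal i). Qed.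

Lemma gamE i : 1 < i -> gam i = 'L_i(G)%G. Proof. by case: i => [|[|i]]. Qed.

(** Only [[~: A, G] = L 2] has content: in [G / [~: A, G]] the image of [A] is central with quotient
    of prime order, so this group is abelian. *)
Lemma gamS i : 0 < i -> gam i.+1 = [~: gam i, G] :> {set gT}.
Proof.
have [sAG nAG'] := andP nAG; case: i => [|[|i]] // _ /=.
have nRG := commg_normr G A.
have sRA : [~: A, G] \subset A by rewrite commg_subl.
apply/eqP; rewrite eqEsubset lcn2 (commSg _ sAG) andbT der1_min //.
apply: (@cyclic_factor_abelian _ (A / [~: A, G])%G (G / [~: A, G])%G).
  by rewrite subsetI quotientS // quotient_cents2r.
rewrite prime_cyclic // card_quotient ?quotient_norms //.
by rewrite index_quotient_eq ?iA // subIset // sRA orbT.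
Qed.

Definition comm_term_le i j k := [~: gam i, gam j] \subset L k.
Local Notation comm_le := comm_term_le.

Lemma comm_leC i j k : comm_le i j k -> comm_le j i k.
Proof. by rewrite /comm_term_le commGC. Qed.

Lemma gam_subS i : gam i.+1 \subset gam i.
Proof.
case: i => [|i] //; rewrite gamS // commg_subl.
exact: normal_norm (gam_normal _).
Qed.

Lemma gam_sub_leq i j : i <= j -> gam j \subset gam i.
Proof.
move/subnK<-; elim: (j - i)%N => // m; exact: subset_trans (gam_subS _).
Qed.

Lemma comm_leW i j k i' j' k' : comm_le i j k ->
  i <= i' -> j <= j' -> k' <= k -> comm_le i' j' k'.
Proof.
move=> c li lj lk; apply: subset_trans (lcn_sub_leq G lk).
by apply: subset_trans c; rewrite commgSS ?gam_sub_leq.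
Qed.

Lemma comm_le_step i j k : 0 < i -> 0 < j ->
  comm_le i j k -> comm_le i.+1 j k.+1 -> comm_le i j.+1 k.+1.
Proof.
move=> i1 j1 c c1; rewrite /comm_term_le (gamS j1) commGC.
apply: (three_subgroup_mod (lcn_normal k.+1 G)); rewrite ?gam_sub //.
  by rewrite [[~: G, gam i]]commGC -(gamS i1).
by apply: subset_trans (lcnSnS _ _); rewrite commSg.
Qed.

(** The direction opposite to [comm_le_step]: the three subgroups lemma puts [[~: gam i, gam j, G]]
    into [L k.+1], and [mc_upper] strips the [G]. *)
Lemma comm_le_up i j k : 0 < i -> 0 < j -> k < n ->
  comm_le i.+1 j k.+1 -> comm_le i j.+1 k.+1 -> comm_le i j k.
Proof.
move=> i1 j1 lt_kn c c1; apply: (mc_upper p_pr n_ge3 oG clG) => //.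
- rewrite /(_ <| _) normsR ?(normal_norm (gam_normal _)) // andbT.
  by rewrite comm_subG ?gam_sub.
- by rewrite lcn2 commgSS ?gam_sub.
- apply: (three_subgroup_mod (lcn_normal k.+1 G)); rewrite ?gam_sub //.
    by rewrite -gamS // commGC.
  by rewrite [[~: G, gam i]]commGC -gamS.
Qed.

Hypothesis derA : A^`(1) \subset L 4.
Hypothesis derL : forall k, 1 < k -> [~: L k, L k] \subset L k.*2.+2.

Lemma comm_le_diag i : 0 < i -> comm_le i i i.*2.+2.
Proof. by case: i => [|[|i]] // _; apply: derL. Qed.

(* The three subgroups lemma moves a bound on [gam i, gam j] to [gam i, gam j.+1];
   start from the diagonal i = j. *)
Lemma comm_le_sum i j : 0 < i -> 0 < j -> comm_le i j (i + j).+1.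
Proof.
wlog le_ij : i j / i <= j => [IH i1 j1|].
  have [/IH->// | /ltnW/IH ji] := leqP i j.
  by apply: comm_leC; rewrite addnC; apply: ji.
have [d] := ubnP (j - i)%N; elim: d i j le_ij => // d IH i j le_ij le_d i1 j1.
have [-> | ne_ij] := eqVneq i j.
  by apply: comm_leW (comm_le_diag j1) _ _ _; lia.
case: j j1 ne_ij le_ij le_d => // j _ ne_ij le_ij le_d.
have j1 : 0 < j by lia.
apply: (@comm_leW i j.+1 (i + j).+2); rewrite ?addnS //.
apply: comm_le_step => //.
  have [-> | ne_d] := eqVneq i j.
    by apply: comm_leW (comm_le_diag j1) _ _ _; lia.
  by apply: IH; lia.
have [le_ij2 | lt_ji] := leqP i.+1 j; last first.
  by apply: comm_leW (comm_le_diag j1) _ _ _; lia.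
by apply: (comm_leW (IH i.+1 j _ _ _ _)); lia.
Qed.

End DegreeOfCommutativity.

(** * Elements and fifth powers *)

Section CommutingProducts.
Local Open Scope nat_scope.
Local Open Scope group_scope.
Variable gT : finGroupType.
Implicit Types (y : nat -> gT) (e f : nat -> nat).

Definition pows k y e : gT := \prod_(i < k) y i ^+ e i.

Lemma powsS k y e : pows k.+1 y e = pows k y e * y k ^+ e k.
Proof. by rewrite /pows big_ord_recr. Qed.

Lemma pows0 y e : pows 0 y e = 1. Proof. by rewrite /pows big_ord0. Qed.

Lemma commute_pows k y e x :
  (forall i, commute x (y i)) -> commute x (pows k y e).
Proof.
move=> cxy; rewrite /pows; elim/big_ind: _ => [|u v cu cv|i _].
- exact: commute1.
- exact: commuteM.
- exact: commuteX.
Qed.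

Lemma powsM k y e f : (forall i j, commute (y i) (y j)) ->
  pows k y e * pows k y f = pows k y (fun i => e i + f i)%N.
Proof.
move=> cy; elim: k => [|k IHk]; first by rewrite !pows0 mulg1.
rewrite !powsS -IHk expgD !mulgA.
congr (_ * _); rewrite -!mulgA; congr (_ * _).
by apply: commute_pows => i; apply/commute_sym/commuteX.
Qed.

Lemma powsMfam k y z e : (forall i j, commute (z i) (y j)) ->
  pows k (fun i => y i * z i) e = pows k y e * pows k z e.
Proof.
move=> czy; elim: k => [|k IHk]; first by rewrite !pows0 mulg1.
rewrite !powsS IHk expgMn; last exact/commute_sym.
rewrite !mulgA; congr (_ * _); rewrite -!mulgA; congr (_ * _).
apply/commute_sym; apply: commute_pows => i.
exact/commute_sym/commuteX.
Qed.

Lemma pows_conj k y e s : pows k y e ^ s = pows k (fun i => y i ^ s) e.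
Proof.
elim: k => [|k IHk]; first by rewrite !pows0 conj1g.
by rewrite !powsS conjMg IHk conjXg.
Qed.

Lemma eq_pows k y z e : y =1 z -> pows k y e = pows k z e.
Proof. by move=> yz; apply: eq_bigr => i _; rewrite yz. Qed.

(** Multiplication by 1 + X on a sequence of coefficients. *)
Definition shift e i := (if i is i'.+1 then e i' + e i else e i)%N.

Lemma conj_pows k y e s : (forall i j, commute (y i) (y j)) ->
    (forall i, y i ^ s = y i * y i.+1) -> y k = 1 ->
  pows k y e ^ s = pows k y (shift e).
Proof.
move=> cy cys yk1; rewrite pows_conj (eq_pows _ _ cys).
rewrite (@powsMfam k y (fun i => y i.+1)) //.
have -> : pows k y (shift e) = pows k y e * pows k y (fun i => if i is i'.+1 then e i' else 0)%N.
  by rewrite powsM // /pows; apply: eq_bigr => -[[|i] lt_i] _ //=; rewrite ?addn0 // addnC.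
congr (_ * _); rewrite /pows; case: k yk1 => [|k] yk1; first by rewrite !big_ord0.
by rewrite big_ord_recr big_ord_recl /= yk1 expg1n mulg1 mul1g.
Qed.

(* The exponents are binomial coefficients: conjugation by s acts on the commuting
   y i as 1 + (shift), and the sum of the first five powers of 1 + X is
   5 + 10 X + 10 X^2 + 5 X^3 + X^4. *)
Lemma norm5_pows y s : (forall i j, commute (y i) (y j)) ->
    (forall i, y i ^ s = y i * y i.+1) -> y 5 = 1 ->
  y 0 * y 0 ^ s * y 0 ^ (s ^+ 2) * y 0 ^ (s ^+ 3) * y 0 ^ (s ^+ 4)
    = y 0 ^+ 5 * y 1%N ^+ 10 * y 2 ^+ 10 * y 3 ^+ 5 * y 4.
Proof.
move=> cy cys y5; pose d i := nat_of_bool (i == 0)%N.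
have y0 : y 0%N = pows 5 y d by rewrite !powsS pows0 /= !expg0 !mulg1 mul1g.
rewrite [s ^+ 2]expgS [s ^+ 3]expgS [s ^+ 4]expgS [s ^+ 2]expgS [s ^+ 3]expgS [s ^+ 2]expgS.
rewrite !expg1 !conjgM y0 !conj_pows // !powsM // -y0.
by rewrite !powsS pows0 mul1g.
Qed.

Lemma expg5_mul_conj (x g : gT) :
  (x * g) ^+ 5 = x ^+ 5 * (g ^ (x ^+ 4) * g ^ (x ^+ 3) * g ^ (x ^+ 2) * g ^ x * g).
Proof.
have step k : g ^ (x ^+ k.+1) = x^-1 * g ^ (x ^+ k) * x by rewrite expgSr conjgM conjgE mulgA.
by rewrite !step expg0 conjg1 !expgS expg0 !mulg1 !mulgA !mulgK.
Qed.

(** Collects the factors [g] on the left. With [expg5_mul_conj] it expands [(x * g) ^+ 5] once each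
    conjugate of [g] is written as [g] times a correction. *)
Lemma mulg_conj5 (g h1 h2 h3 h4 : gT) :
  g * h4 * (g * h3) * (g * h2) * (g * h1) * g =
    g ^+ 5 * (h4 ^ (g ^+ 4) * h3 ^ (g ^+ 3) * h2 ^ (g ^+ 2) * h1 ^ g).
Proof.
have step h k : h ^ (g ^+ k.+1) = g^-1 * h ^ (g ^+ k) * g by rewrite expgSr conjgM conjgE mulgA.
by rewrite !step expg0 !conjg1 !expgS expg0 !mulg1 !mulgA !mulgK.
Qed.

End CommutingProducts.

Section ShiftRelations.
Local Open Scope group_scope.

(** The index of [a2], ..., [a5] is the term each belongs to in the application, with [g] in the
    first. As [s] sends each to its product with the next, commutators expand bilinearly once the
    listed pairs commute. *)
Lemma comm_shift_relations (hT : finGroupType) (s g a2 a3 a4 a5 : hT) :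
    let e := [~ a3, g] in let f := [~ a4, g] in
    let h := [~ a3, a2] in let z := [~ a4, a2] in
    g ^ s = g * a2 -> a2 ^ s = a2 * a3 -> a3 ^ s = a3 * a4 -> a4 ^ s = a4 * a5 ->
    commute a3 a4 -> commute a5 a2 -> commute a5 g ->
    commute h a3 -> commute h a4 -> commute z a3 -> commute z a5 ->
    commute f a5 -> commute f a2 -> commute e a4 -> commute e a2 ->
  [/\ h ^ s = h * z, f ^ s = z * f & e ^ s = h * z * (e * f)].
Proof.
move=> e f h z gs s2 s3 s4 c34 c52 c5g ch3 ch4 cz3 cz5 cf5 cf2 ce4 ce2.
have fix_ (x y : hT) : commute x y -> x ^ y = x by move=> cxy; apply/conjg_fixP/commgP.
have comm1 (x y : hT) : commute x y -> [~ x, y] = 1 by move=> cxy; apply/eqP/commgP.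
have hz : [~ a3 * a4, a2] = h * z by rewrite commMgJ fix_.
have ef : [~ a3 * a4, g] = e * f by rewrite commMgJ fix_.
split.
- rewrite conjRg s3 s2 commgMJ hz fix_ ?comm1 ?mul1g //.
    exact/commute_sym/commuteM/commute_sym.
  by apply/commute_sym/commuteM; apply/commute_sym.
- rewrite conjRg s4 gs commgMJ !commMgJ (comm1 a5 a2) // (comm1 a5 g) // !mulg1.
  by rewrite -/z -/f !fix_.
- rewrite conjRg s3 gs commgMJ hz ef fix_ //.
  by apply/commute_sym/commuteM; apply/commute_sym.
Qed.

End ShiftRelations.

(** * Generators of the terms, and commutation with an element outside [A] *)

Section MaximalClassElements.
Local Open Scope nat_scope.
Local Open Scope group_scope.
Variables (p : nat) (gT : finGroupType) (G A : {group gT}) (n : nat).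
Hypotheses (p_pr : prime p) (n_ge3 : 2 < n) (oG : #|G| = (p ^ n)%N).
Hypothesis clG : nil_class G = n.-1.
Hypotheses (nAG : A <| G) (iA : #|G : A| = p).
Local Notation L i := 'L_i(G).
Local Notation gam := (mc_term G A).
Local Notation comm_le := (comm_term_le G A).
Hypothesis dc : forall i j, 0 < i -> 0 < j -> comm_le i j (i + j).+1.

Let gam_normal := gam_normal nAG.
Let gam_sub := gam_sub nAG.
Let gam_norm i : G \subset 'N(gam i) := normal_norm (gam_normal i).
Let gamS := gamS p_pr nAG iA.
Let gam_subS := gam_subS p_pr nAG iA.
Let gam_sub_leq := gam_sub_leq p_pr nAG iA.

Lemma card_gam i : 0 < i <= n -> #|gam i| = (p ^ (n - i))%N.
Proof.
case: i => [|[|i]] // /andP[_ le_in] /=; last by rewrite (mc_card_lcn p_pr n_ge3 oG clG).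
apply/eqP; rewrite -(eqn_pmul2r (prime_gt0 p_pr)) -{1}iA Lagrange ?normal_sub //.
by rewrite oG -expnSr subn1 prednK // ltnW // ltnW.
Qed.

Lemma gam_triv i : n <= i -> gam i = 1 :> {set gT}.
Proof.
case: i => [|[|i]] le_ni /=; last by rewrite (mc_lcn_triv p_pr n_ge3 oG clG).
  by have := leq_trans n_ge3 le_ni.
by have := leq_trans n_ge3 le_ni.
Qed.

Lemma gam_index i : 0 < i < n -> #|gam i : gam i.+1| = p.
Proof.
case/andP=> i0 lt_in; rewrite -divgS ?gam_subS // !card_gam ?i0 //; last exact: ltnW.
by rewrite -expnB ?prime_gt0 ?leq_sub2l //; rewrite (_ : (_ - _ = 1)%N) ?expn1 //; lia.
Qed.

Lemma gam_proper i : 0 < i < n -> ~~ (gam i \subset gam i.+1).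
Proof. by move=> i1n; rewrite -indexg_eq1 gam_index // neq_ltn prime_gt1 ?orbT. Qed.

Lemma gam_gen (H : {group gT}) i x :
  0 < i -> x \in gam i -> x \notin gam i.+1 -> x \in H -> gam i.+1 \subset H ->
  gam i \subset H.
Proof.
move=> i0 xi nxi xH sH.
have [le_ni | lt_in] := leqP n i.
  by apply: subset_trans sH; rewrite (gam_triv le_ni) sub1G.
by apply: prime_index_gen xi nxi xH sH; rewrite ?gam_subS // gam_index ?i0.
Qed.

Lemma gam_levelP x : x \in A -> x != 1 ->
  exists i, [/\ 0 < i < n, x \in gam i & x \notin gam i.+1].
Proof.
move=> xA x1; pose P i := (x \notin gam i.+1).
have exP : exists i, P i.
  by exists n; rewrite /P gam_triv // inE.
have [i Pi min] := ex_minnP exP.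
case: i => [|i] in Pi min *; first by rewrite /P /= xA in Pi.
have xi : x \in gam i.+1 by apply: contraT => /min; rewrite ltnn.
exists i.+1; split=> //=; rewrite ltnNge; apply: contra x1 => le_n.
by rewrite gam_triv // inE in xi.
Qed.

(** [gam i] is generated by [x] and [gam i.+1], and centralizing [gam j] modulo [L k] defines a
    subgroup. *)
Lemma comm_le_gen i j k x : 0 < i -> x \in gam i -> x \notin gam i.+1 ->
  comm_le i.+1 j k -> {in gam j, forall y, [~ x, y] \in L k} -> comm_le i j k.
Proof.
move=> i0 xi nxi c cx; have nL := lcn_norm k G.
have nX i' : gam i' \subset 'N(L k) := subset_trans (gam_sub _) nL.
have nx : [set x] \subset 'N(L k) by rewrite sub1set (subsetP (nX i)).
rewrite /comm_term_le -quotient_cents2 // sub_quotient_pre //.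
apply: (gam_gen i0 xi nxi); last by rewrite -sub_quotient_pre // quotient_cents2.
rewrite -sub1set -sub_quotient_pre // quotient_cents2 // gen_subG.
by apply/subsetP=> _ /imset2P[_ y /set1P-> yj ->]; apply: cx.
Qed.

Lemma exists_gam_gen i : 0 < i < n -> exists2 x, x \in gam i & x \notin gam i.+1.
Proof. by move/gam_proper/subsetPn=> [x]; exists x. Qed.

Lemma gam_pred_central x y : x \in gam n.-1 -> y \in G -> [~ x, y] = 1.
Proof.
move=> xn yG; apply/set1P; rewrite -set1gE -(gam_triv (leqnn n)).
have n1 : 0 < n.-1 by lia.
by rewrite -(ltn_predK n_ge3) gamS // mem_commg.
Qed.

Section OutsideElement.
Variable s : gT.
Hypotheses (sG : s \in G) (nsA : s \notin A).

Lemma outer_gen (H : {group gT}) : s \in H -> A \subset H -> G \subset H.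
Proof.
by move=> sH sAH; apply: prime_index_gen sG nsA sH sAH; rewrite ?normal_sub ?iA.
Qed.

Lemma comm_outer_in i x : 0 < i -> x \in gam i -> [~ x, s] \in gam i.+1.
Proof. by move=> i0 xi; rewrite gamS // mem_commg. Qed.

(** Otherwise [x] is central modulo [gam i.+2], since [s] and [A] generate [G] and [[~: gam i, A]]
    already lies there. Then so is [gam i], generated by [x] and [gam i.+1], which forces [gam i.+1]
    into [gam i.+2]. *)
Lemma comm_outer i x : 0 < i -> i.+1 < n -> x \in gam i -> x \notin gam i.+1 ->
  [~ x, s] \notin gam i.+2.
Proof.
move=> i0 lt_in xi nxi; apply/negP=> xs.
have nG2 := gam_norm i.+2; have nx : x \in 'N(gam i.+2) by rewrite (subsetP nG2) ?(subsetP (gam_sub i)).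
have sX : [set x] \subset 'N(gam i.+2) by rewrite sub1set.
have sS : [set s] \subset 'N(gam i.+2) by rewrite sub1set (subsetP nG2).
have sAN : A \subset 'N(gam i.+2) := subset_trans (normal_sub nAG) nG2.
have sGx : G \subset coset (gam i.+2) @*^-1 'C([set x] / gam i.+2).
  apply: outer_gen.
    rewrite -sub1set -sub_quotient_pre // quotient_cents2 //.
    rewrite commGC gen_subG.
    by apply/subsetP=> _ /imset2P[_ _ /set1P-> /set1P-> ->].
  rewrite -sub_quotient_pre // quotient_cents2 // gen_subG.
  apply/subsetP=> _ /imset2P[a _ aA /set1P-> ->].
  have := dc i0 (ltnSn 0); rewrite addn1 => /subsetP; apply.
  by rewrite commGC mem_commg.
have sxG : [~: [set x], G] \subset gam i.+2.
  by rewrite -quotient_cents2 // centsC sub_quotient_pre.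
have: gam i \subset coset (gam i.+2) @*^-1 'C(G / gam i.+2).
  apply: (gam_gen i0 xi nxi).
    by rewrite -sub1set -sub_quotient_pre ?quotient_cents2.
  rewrite -sub_quotient_pre ?quotient_cents2 // ?(subset_trans (gam_sub _)) //.
  by rewrite -gamS.
rewrite -sub_quotient_pre ?quotient_cents2 // ?(subset_trans (gam_sub _)) // -gamS //.
exact/negP/gam_proper.
Qed.

Lemma cent_outer x : x \in A -> [~ x, s] = 1 -> x \in gam n.-1.
Proof.
move=> xA xs; have [-> | /(gam_levelP xA)[i [/andP[i0 lt_in] xi nxi]]] := eqVneq x 1.
  exact: group1.
have [lt_i1n | le_ni] := ltnP i.+1 n.
  by have := comm_outer i0 lt_i1n xi nxi; rewrite xs group1.
by rewrite (_ : n.-1 = i) //; lia.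
Qed.

(** The power lies in [A] and commutes with [s], so [cent_outer] applies. *)
Lemma outer_expg : s ^+ p \in gam n.-1.
Proof.
apply: cent_outer; last by apply/eqP/commgP/commute_sym/commuteX.
have nAs : s \in 'N(A) by rewrite (subsetP (normal_norm nAG)).
apply: coset_idr (groupX p nAs) _; rewrite morphX //.
have : coset A s \in G / A by rewrite mem_quotient.
by move/expg_cardG; rewrite card_quotient ?normal_norm // iA.
Qed.

(** Counting: the conjugates of [s] under [gam i] lie in the coset [s *: gam i.+1], and fill it
    because the stabilizer of [s] lies in [gam n.-1], of order [p]. *)
Lemma comm_outer_surj i y : 0 < i -> y \in gam i.+1 -> exists2 t, t \in gam i & y = [~ t, s].
Proof.
move=> i0 yi; have [le_ni | lt_in] := leqP n i.
  exists 1; rewrite ?group1 // comm1g.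
  by apply/set1P; rewrite -set1gE -(gam_triv (leqW le_ni)).
have sub : s ^: gam i \subset s *: gam i.+1.
  apply/subsetP=> _ /imsetP[t ti ->]; rewrite conjg_mulR mem_lcoset mulKg.
  by rewrite -groupV invg_comm comm_outer_in.
have /eqP eqs : s ^: gam i == s *: gam i.+1.
  have bi : 0 < i <= n by rewrite i0 ltnW.
  have oC : #|'C_(gam i)[s]| <= p.
    rewrite -(expn1 p) -(_ : (n - n.-1)%N = 1%N); last lia.
    rewrite -card_gam; last lia.
    apply/subset_leq_card/subsetP=> x /setIP[xi /cent1P cxs].
    apply: cent_outer; first exact: (subsetP (gam_sub_leq i0)).
    by apply/eqP/commgP.
  rewrite eqEcard sub card_lcoset (card_gam (i := i.+1)) // -index_cent1.
  rewrite -(leq_pmul2l (cardG_gt0 'C_(gam i)[s])) Lagrange ?subsetIl // card_gam //.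
  apply: leq_trans (leq_mul oC (leqnn _)) _.
  by rewrite -expnS; apply: eq_leq; congr (_ ^ _)%N; lia.
have: s * y^-1 \in s *: gam i.+1 by rewrite mem_lcoset mulKg groupV.
rewrite -eqs => /imsetP[t ti Dst]; exists t => //.
by move: Dst; rewrite conjg_mulR => /mulgI/(canRL invgK)->; rewrite invg_comm.
Qed.

End OutsideElement.

End MaximalClassElements.

(** * Fifth powers move down four terms *)

Section FifthPowers.
Local Open Scope nat_scope.
Local Open Scope group_scope.
Variables (gT : finGroupType) (G A : {group gT}) (n : nat).
Hypotheses (n_ge3 : 2 < n) (oG : #|G| = (5 ^ n)%N) (clG : nil_class G = n.-1).
Hypotheses (nAG : A <| G) (iA : #|G : A| = 5).
Local Notation L i := 'L_i(G).
Local Notation gam := (mc_term G A).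
Local Notation comm_le := (comm_term_le G A).
Hypothesis dc : forall i j, 0 < i -> 0 < j -> comm_le i j (i + j).+1.
Hypothesis dcd : forall i, 1 < i -> comm_le i i i.*2.+2.
Variable s : gT.
Hypotheses (sG : s \in G) (nsA : s \notin A).

Let p_pr : prime 5. Proof. by []. Qed.
Let gam_sub := gam_sub nAG.
Let gam_norm i : G \subset 'N(gam i) := normal_norm (gam_normal nAG i).
Let gamS := gamS p_pr nAG iA.
Let gam_sub_leq := gam_sub_leq p_pr nAG iA.
Let in_gam_leq i j x : i <= j -> x \in gam j -> x \in gam i.
Proof. by move=> le_ij; apply: subsetP (gam_sub_leq le_ij) x. Qed.

Let comm_outer_in := comm_outer_in p_pr nAG iA sG.
Let comm_outer := comm_outer p_pr n_ge3 oG clG nAG iA dc sG nsA.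
Let comm_outer_surj := comm_outer_surj p_pr n_ge3 oG clG nAG iA dc sG nsA.
Let outer_expg_in := outer_expg p_pr n_ge3 oG clG nAG iA dc.
Let gam_pred_central := gam_pred_central p_pr n_ge3 oG clG nAG iA.
Let gam_triv := gam_triv A p_pr n_ge3 oG clG.

Definition itcomm x i := iter i (fun z => [~ z, s]) x.

Lemma itcomm_in j x i : 0 < j -> x \in gam j -> itcomm x i \in gam (j + i).
Proof.
move=> j0 xj; elim: i => [|i IHi]; first by rewrite addn0.
by rewrite addnS; apply: comm_outer_in; rewrite ?addn_gt0 ?j0.
Qed.

Lemma itcomm_notin j x i : 0 < j -> j + i < n ->
  x \in gam j -> x \notin gam j.+1 -> itcomm x i \notin gam (j + i).+1.
Proof.
move=> j0 + xj nxj; elim: i => [|i IHi]; first by rewrite addn0.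
rewrite addnS => lt_n; have := itcomm_in i j0 xj => iti.
apply: comm_outer => //; first by rewrite addn_gt0 j0.
by apply: IHi; apply: ltnW.
Qed.

(* Write y = [t, s]: the product telescopes to t^-1 * t ^ (s ^+ 5). *)
Lemma norm_comm_outer i y : 1 < i -> y \in gam i ->
  y * y ^ s * y ^ (s ^+ 2) * y ^ (s ^+ 3) * y ^ (s ^+ 4) = 1.
Proof.
case: i => // i i0 yi.
have [t ti Dy] := comm_outer_surj i0 yi.
have tA : t \in A := in_gam_leq (leq0n i) ti.
have s5 := outer_expg_in sG nsA.
have tG := subsetP (normal_sub nAG) _ tA.
have ts5 : t ^ (s ^+ 5) = t.
  apply/conjg_fixP; rewrite -invg_comm.
  by rewrite (gam_pred_central s5 tG) invg1.
apply: (mulgI t); rewrite mulg1 -[RHS]ts5.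
have Dt : t ^ s = t * y by rewrite conjg_mulR Dy.
have step k : t ^ (s ^+ k.+1) = t ^ (s ^+ k) * y ^ (s ^+ k).
  by rewrite expgS conjgM Dt conjMg.
by rewrite !step expg0 !conjg1 expg1 !mulgA.
Qed.

Local Notation q k := (coset (gam k)).
Let qM k x y : x \in G -> y \in G -> q k (x * y) = q k x * q k y.
Proof. by move=> xG yG; rewrite morphM // (subsetP (gam_norm k)). Qed.
Let qJ k x y : x \in G -> y \in G -> q k (x ^ y) = q k x ^ q k y.
Proof. by move=> xG yG; rewrite morphJ // (subsetP (gam_norm k)). Qed.
Let qX k x m : x \in G -> q k (x ^+ m) = q k x ^+ m.
Proof. by move=> xG; rewrite morphX // (subsetP (gam_norm k)). Qed.
Let qR k x y : x \in G -> y \in G -> q k [~ x, y] = [~ q k x, q k y].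
Proof. by move=> xG yG; rewrite morphR // (subsetP (gam_norm k)). Qed.
Let q1 k x : x \in gam k -> q k x = 1. Proof. exact: coset_id. Qed.
Let q1P k x : x \in G -> q k x = 1 -> x \in gam k.
Proof. by move=> xG; apply: coset_idr; rewrite (subsetP (gam_norm k)). Qed.

(** The product of the conjugates of [y] is 1 by [norm_comm_outer]. Modulo [gam k], [norm5_pows]
    evaluates it as [y ^+ 5 * itcomm y 4], since the middle exponents 10, 10 and 5 are killed by the
    hypothesis on [gam j.+1]. *)
Lemma fifth_power_step k j y : 1 < j -> k <= j + 5 -> y \in gam j ->
    [~: gam j, gam j] \subset gam k -> {in gam j.+1, forall z, z ^+ 5 \in gam k} ->
  y ^+ 5 * itcomm y 4 \in gam k.
Proof.
move=> j1 kj yj abj pj; have j0 := ltnW j1.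
have itG i : itcomm y i \in G by apply: (subsetP (gam_sub (j + i))); apply: itcomm_in.
have itj i : itcomm y i \in gam j by apply: in_gam_leq (itcomm_in i j0 yj); apply: leq_addr.
pose Y i := q k (itcomm y i).
have cY i i' : commute (Y i) (Y i').
  apply/commgP/eqP; rewrite -qR //; apply/q1/(subsetP abj).
  by rewrite mem_commg.
have sY i : Y i ^ q k s = Y i * Y i.+1 by rewrite /Y -qJ // conjg_mulR qM // groupR.
have Y5 : Y 5 = 1 by apply/q1/(in_gam_leq kj)/itcomm_in.
have p5 i : 0 < i -> Y i ^+ 5 = 1.
  move=> i0; rewrite -qX //; apply/q1/pj.
  by apply: in_gam_leq (itcomm_in i j0 yj); rewrite -addn1 leq_add2l.
have p10 i : 0 < i -> Y i ^+ 10 = 1.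
  by move=> i0; rewrite (expgM (Y i) 5 2) p5 // expg1n.
have yG : y \in G := itG 0%N.
have yJ i : y ^ (s ^+ i) \in G by rewrite groupJ ?groupX.
have yJs : y ^ s \in G := yJ 1%N.
have sX i : s ^+ i \in G by rewrite groupX.
have: q k (y * y ^ s * y ^ (s ^+ 2) * y ^ (s ^+ 3) * y ^ (s ^+ 4)) = 1.
  by rewrite (norm_comm_outer j1 yj) morph1.
have m1 := groupM yG yJs; have m2 := groupM m1 (yJ 2); have m3 := groupM m2 (yJ 3).
rewrite (qM _ m3 (yJ 4)) (qM _ m2 (yJ 3)) (qM _ m1 (yJ 2)) (qM _ yG yJs) !qJ // !qX //.
rewrite -[q k y]/(Y 0%N) norm5_pows // (p5 3) // !p10 // !mulg1 => E.
apply: q1P; first by rewrite groupM ?groupX.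
by rewrite qM ?groupX // qX.
Qed.

Lemma fifth_power_in j : 1 < j -> {in gam j, forall z, z ^+ 5 \in gam (j + 4)}.
Proof.
have [d] := ubnP (n - j)%N; elim: d j => // d IHd j le_d j1 z zj.
have [le_nj | lt_jn] := leqP n j.
  move: zj; rewrite gam_triv // => /set1P->.
  by rewrite expg1n group1.
suffices: z ^+ 5 * itcomm z 4 \in gam (j + 4).
  by rewrite groupMr // itcomm_in // ltnW.
apply: (fifth_power_step j1 _ zj); first lia.
  apply: subset_trans (dcd j1) _.
  by apply: (@gam_sub_leq (j + 4) j.*2.+2); lia.
move=> w wj; have := IHd j.+1 _ _ w wj; rewrite addSn => h.
by apply: in_gam_leq (h _ _); lia.
Qed.

Lemma fifth_power_notin j y : 1 < j -> j + 4 < n -> comm_le j j (j + 5) ->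
  y \in gam j -> y \notin gam j.+1 -> y ^+ 5 \notin gam (j + 5).
Proof.
move=> j1 lt_n abj yj nyj.
have: y ^+ 5 * itcomm y 4 \in gam (j + 5).
  apply: (fifth_power_step j1 _ yj) => //.
    by rewrite [gam (j + 5)]gamE //; lia.
  move=> w wj; have := fifth_power_in (leqW j1) wj.
  by apply: in_gam_leq; rewrite addSnnS.
move=> h; apply/negP=> h5; move: h; rewrite groupMl //.
by apply/negP; rewrite addnS; apply: itcomm_notin => //; apply: ltnW.
Qed.

(* Both s and s * g lie outside A, so their fifth powers lie in gam n.-1. *)
Lemma fifth_power_outer g : 6 < n -> g \in A -> g \notin gam 2 ->
  g ^+ 5 \in gam 5 /\ g ^+ 5 \notin gam 6.
Proof.
move=> n7 gA ng2; have gG : g \in G := subsetP (normal_sub nAG) _ gA.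
have g1 : g \in gam 1 := gA.
have itg i := itcomm_in i (ltn0Sn 0) g1; rewrite -/(gam 1) in itg.
have itG i : itcomm g i \in G := subsetP (gam_sub _) _ (itg i).
have it5 i : 3 < i -> itcomm g i.+1 \in gam 6 by move=> i4; apply: in_gam_leq (itg i.+1).
suffices eq1 : q 6 g ^+ 5 * q 6 (itcomm g 4) = 1.
  have p5 : g ^+ 5 * itcomm g 4 \in gam 6.
    by apply: q1P; [rewrite groupM ?groupX | rewrite qM ?groupX // qX].
  have it4 : itcomm g 4 \in gam 5 := itg 4.
  have nit4 : itcomm g 4 \notin gam 6.
    by apply: (@itcomm_notin 1 g 4) => //; apply: leq_trans n7.
  split; last by apply: contra nit4 => h6; rewrite -(groupMl _ h6).
  by rewrite -(groupMr _ it4); apply: in_gam_leq p5.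
(* [Z 0], ..., [Z 3] are iterated commutators of [g] with [s]; [Z 4 = [~ Z 0, g]] and [Z 5 =
   [~ Z 1, g]] are the only commutators with [g] that survive modulo [gam 6]. Conjugation by [g]
   therefore acts on exponents as [dg] below. *)
pose Z i := if i is 4 then [~ itcomm g 1, g] else if i is 5 then [~ itcomm g 2, g]
  else if i < 4 then itcomm g i.+1 else 1.
pose Y i := q 6 (Z i).
pose y i := q 6 (itcomm g i.+1).
have ZG i : Z i \in G.
  move: i; do 4![case=> [|]; first exact: itG].
  by do 2![case=> [|]; first exact: groupR] => i; exact: group1.
have Z4 : Z 4 \in gam 4.
  exact: subsetP (dc (ltn0Sn 1) (ltn0Sn 0) : [~: gam 2, gam 1] \subset L 4) _ (mem_commg (itg 1%N) g1).
have Z5 : Z 5 \in gam 5.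
  exact: subsetP (dc (ltn0Sn 2) (ltn0Sn 0) : [~: gam 3, gam 1] \subset L 5) _ (mem_commg (itg 2) g1).
have q_comm x z : x \in gam 2 -> z \in gam 2 -> commute (q 6 x) (q 6 z).
  move=> x2 z2; have [xG zG] := (subsetP (gam_sub _) _ x2, subsetP (gam_sub _) _ z2).
  apply/commgP/eqP; rewrite -qR //; apply/q1/(subsetP (dcd (ltnSn 1))).
  exact: mem_commg.
have it2 i : itcomm g i.+1 \in gam 2 by apply: in_gam_leq (itg i.+1).
have Z2 i : Z i \in gam 2.
  move: i; do 4![case=> [|]; first exact: it2]; case; first exact: in_gam_leq Z4.
  by case=> [|i]; [exact: in_gam_leq Z5 | exact: group1].
have cY i j : commute (Y i) (Y j) by apply: q_comm.
have cy i j : commute (y i) (y j) by apply: q_comm.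
have ys i : y i ^ q 6 s = y i * y i.+1 by rewrite /y -qJ // conjg_mulR qM // groupR.
have y4 : y 4 = 1 by apply/q1/it5.
have yY e : e 4 = 0%N -> e 5 = 0%N -> pows 4 y e = pows 6 Y e.
  by move=> e4 e5; rewrite !powsS !pows0 e4 e5 !expg0 !mulg1.
pose W i := if i is 0 then Y 4 else if i is 1 then Y 5 else 1.
have Yg i : Y i ^ q 6 g = Y i * W i.
  rewrite /Y -qJ // conjg_mulR qM ?groupR //; congr (_ * _).
  have c4 z : z \in gam 4 -> q 6 [~ z, g] = 1.
    move=> z4; apply/q1.
    exact: subsetP (dc (ltn0Sn 3) (ltn0Sn 0) : [~: gam 4, gam 1] \subset L 6) _ (mem_commg z4 g1).
  case: i => [|[|i]] //; apply: c4; case: i => [|i]; first exact: itg 3.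
  case: i => [|i]; first by apply: in_gam_leq (itg 4).
  case: i => [|i]; first exact: Z4.
  case: i => [|i]; first by apply: in_gam_leq Z5.
  exact: group1.
pose dg e i : nat := if i is 4 then (e 4 + e 0%N)%N else if i is 5 then (e 5 + e 1%N)%N else e i.
have Yconj e : pows 6 Y e ^ q 6 g = pows 6 Y (dg e).
  rewrite pows_conj (eq_pows _ _ Yg) (@powsMfam _ 6 Y W); last first.
    by case=> [|[|i]] j; [exact: cY | exact: cY | exact: commute_sym (commute1 _)].
  have -> : pows 6 W e = pows 6 Y (fun i => if i is 4 then e 0%N else if i is 5 then e 1%N else 0)%N.
    by rewrite !powsS !pows0 !expg1n !expg0 !mulg1 !mul1g.
  rewrite powsM // !powsS !pows0 /= !addn0 //.
pose d i := nat_of_bool (i == 0)%N.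
(* [E k] lists the coefficients of ((1 + X)^(k+1) - 1) / X, the exponents in the conjugate of [g] by
   the power [k.+1] of [s]. *)
pose E := fix E k := if k is k'.+1 then (fun i => d i + shift (E k') i)%N else d.
have y0E : y 0%N = pows 4 y d by rewrite !powsS pows0 /= !expg0 !mulg1 mul1g.
have gs : q 6 g ^ q 6 s = q 6 g * y 0%N by rewrite -qJ // conjg_mulR qM // groupR.
have gsE k : q 6 g ^ (q 6 s ^+ k.+1) = q 6 g * pows 4 y (E k).
  elim: k => [|k IHk]; first by rewrite expg1 gs y0E.
  by rewrite expgSr conjgM IHk conjMg gs conj_pows // -mulgA [in LHS]y0E powsM.
have tail x : x \in gam n.-1 -> q 6 x = 1.
  by move=> xn; apply/q1; apply: in_gam_leq xn; lia.
have s5 : q 6 s ^+ 5 = 1 by rewrite -qX //; apply/tail/outer_expg_in.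
have sg5 : (q 6 s * q 6 g) ^+ 5 = 1.
  rewrite -qM // -qX ?groupM //; apply/tail/outer_expg_in; first exact: groupM.
  by rewrite groupMr.
move: sg5; rewrite expg5_mul_conj s5 mul1g.
have -> : q 6 g ^ q 6 s = q 6 g * pows 4 y (E 0%N) by rewrite -(gsE 0%N) expg1.
rewrite !gsE !yY // mulg_conj5.
have -> : (q 6 g ^+ 4 = q 6 g * q 6 g * q 6 g * q 6 g) by rewrite !expgSr expg0 mul1g.
have -> : (q 6 g ^+ 3 = q 6 g * q 6 g * q 6 g) by rewrite !expgSr expg0 mul1g.
have -> : (q 6 g ^+ 2 = q 6 g * q 6 g) by rewrite !expgSr expg0 mul1g.
rewrite !conjgM !Yconj !powsM //.
have p5 i : Y i ^+ 5 = 1 by rewrite -qX //; apply/q1/(fifth_power_in _ (Z2 i)).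
rewrite !powsS pows0 mul1g.
(* For k from 1 to 4, [Y 0], ..., [Y 3] collect the sums of binomial(k, i + 1), which are 10, 10, 5
   and 1; [Y 4] collects the sum of k^2, which is 30, and [Y 5] the sum of k binomial(k, 2), which
   is 35. Only the exponent of [Y 3], the image of [itcomm g 4], is prime to 5. *)
have p5k i k : Y i ^+ (5 * k) = 1 by rewrite expgM p5 expg1n.
rewrite [Y 0%N ^+ _](p5k 0%N 2) [Y 1%N ^+ _](p5k 1%N 2) [Y 2%N ^+ _](p5k 2 1%N).
rewrite [Y 4 ^+ _](p5k 4 6) [Y 5 ^+ _](p5k 5 7) !mul1g !mulg1 => <-.
by rewrite expg1.
Qed.

End FifthPowers.

(** * Sharpening the bounds on commutators of terms by means of fifth powers *)

Section SecondTermCommutators.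
Local Open Scope nat_scope.
Local Open Scope group_scope.
Variables (gT : finGroupType) (G A : {group gT}) (n : nat).
Hypotheses (n_ge7 : 6 < n) (oG : #|G| = (5 ^ n)%N) (clG : nil_class G = n.-1).
Hypotheses (nAG : A <| G) (iA : #|G : A| = 5).
Local Notation L i := 'L_i(G).
Local Notation gam := (mc_term G A).
Local Notation c := (comm_term_le G A).
Hypothesis dc : forall i j, 0 < i -> 0 < j -> c i j (i + j).+1.
Hypothesis dcd : forall i, 1 < i -> c i i i.*2.+2.

Let p_pr : prime 5. Proof. by []. Qed.
Let n_ge3 : 2 < n. Proof. exact: leq_trans n_ge7. Qed.
Let gam_sub := gam_sub nAG.
Let gam_norm i : G \subset 'N(gam i) := normal_norm (gam_normal nAG i).
Let gam_sub_leq := gam_sub_leq p_pr nAG iA.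
Let in_gam_leq i j x : i <= j -> x \in gam j -> x \in gam i.
Proof. by move=> le_ij; apply: subsetP (gam_sub_leq le_ij) x. Qed.
Let exists_gam_gen i := exists_gam_gen p_pr n_ge3 oG clG nAG iA (i := i).
Let gam_gen := gam_gen p_pr n_ge3 oG clG nAG iA.
Let c_gen := comm_le_gen p_pr n_ge3 oG clG nAG iA.
Let c_step := comm_le_step p_pr nAG iA.
Let c_up := comm_le_up p_pr n_ge3 oG clG nAG iA.
Let cW := comm_leW p_pr nAG iA.
Let c_in i j k x y : c i j k -> x \in gam i -> y \in gam j -> [~ x, y] \in L k.
Proof. by move=> cijk xi yj; apply: (subsetP cijk); apply: mem_commg. Qed.

Lemma exists_outer : exists2 s, s \in G & s \notin A.
Proof.
apply/subsetPn; rewrite -indexg_eq1 iA //.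
Qed.

Lemma comm_gen_left i x k g : 0 < i -> x \in gam i -> x \notin gam i.+1 ->
    g \in G -> [~ x, g] \in L k -> {in gam i.+1, forall y, [~ y, g] \in L k} ->
  {in gam i, forall y, [~ y, g] \in L k}.
Proof.
move=> i0 xi nxi gG xg yg y yi; have nL := lcn_norm k G.
have H1 z : z \in G -> (z \in coset (L k) @*^-1 'C[coset (L k) g]) = ([~ z, g] \in L k).
  move=> zG; have [zN gN] := (subsetP nL z zG, subsetP nL g gG).
  rewrite morphpreE in_setI zN inE /=; apply/cent1P/idP => [czg | zgL].
    apply: coset_idr; first by rewrite groupR.
    by rewrite morphR //; apply/eqP/commgP.
  by apply/commgP/eqP; rewrite -morphR //; apply: coset_id.
have xG := subsetP (gam_sub i) x xi; have yG := subsetP (gam_sub i) y yi.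
rewrite -H1 //; apply: (subsetP (gam_gen i0 xi nxi _ _)) yi; first by rewrite H1.
by apply/subsetP=> z zi; rewrite H1 ?yg // (subsetP (gam_sub _) z zi).
Qed.

(* gam 5 is generated by gam 6 and g ^+ 5, which commutes with g. *)
Lemma comm_le_1_5 k : k <= n -> c 2 5 k -> c 1 5 k.
Proof.
move=> le_kn c25; have [s sG nsA] := exists_outer.
have [g g1 ng2] : exists2 g, g \in gam 1 & g \notin gam 2.
  by apply: exists_gam_gen; apply: leq_trans n_ge7.
have [g5 ng6] := fifth_power_outer n_ge3 oG clG nAG iA dc dcd sG nsA n_ge7 g1 ng2.
have gG := subsetP (gam_sub 1) g g1.
(* One step at a time: [c 1 5 i] and [c 2 5 k] give [c 1 6 i.+1]. As [g ^+ 5] commutes with [g],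
   this bounds the commutators of [gam 5] with [g], and [gam 1] is generated by [g] and [gam 2]. *)
suffices: forall i, i <= k -> c 1 5 i by apply.
elim=> [_ | i IHi lt_ik]; first by apply: comm_subG; apply: gam_sub.
have c16 : c 1 6 i.+1.
  by apply: c_step => //; [apply: IHi; apply: ltnW | apply: cW c25 _ _ _].
apply: (c_gen _ g1 ng2) => //; first by apply: cW c25 _ _ _.
move=> y y5; rewrite -groupV invg_comm.
apply: (comm_gen_left _ g5 ng6 gG _ _ y5) => //.
  suffices -> : [~ g ^+ 5, g] = 1 by apply: group1.
  by apply/eqP/commgP/commute_sym/commuteX.
by move=> z z6; rewrite -groupV invg_comm; apply: c_in c16 _ z6.
Qed.

(* From [L 2, L 2] <= L m and [L 3, L 3] <= L m.+1, star_3_3 improves the second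
   bound by one step. If the first one could not be improved, then
   star_no_commutator makes g fix a linear character of L 3 whose kernel contains
   L m.+2 but not L m.+1, which is excluded in a normally monomial group. *)
Section Star.
Variable m : nat.
Hypotheses (lt_mn : m.+2 <= n) (m_ge6 : 5 < m).
Hypotheses (c22 : c 2 2 m) (c33 : c 3 3 m.+1).

Lemma star_2_4 : c 2 4 m.+1.
Proof. by apply: c_step => //; apply: cW c22 _ _ _. Qed.
Let c24 := star_2_4.

Lemma star_1_5 : c 1 5 m.+1.
Proof. by apply: comm_le_1_5; [apply: ltnW | apply: cW c24 _ _ _]. Qed.
Let c15 := star_1_5.

(** Here and in the next two lemmas each step down from [star_1_5] costs one term:
    [[~: gam 1, gam j]] lies in [L (m + j - 4)] for j = 4, 3, 2. *)
Lemma star_1_4 : c 1 4 m.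
Proof. by apply: c_up => //; apply: ltnW. Qed.
Let c14 := star_1_4.

Lemma star_1_3 : c 1 3 m.-1.
Proof.
by apply: c_up; rewrite ?(ltn_predK m_ge6) //; [move: lt_mn; clear; lia | apply: cW c22 _ _ _; clear; lia].
Qed.
Let c13 := star_1_3.

Lemma star_1_2 : c 1 2 m.-2.
Proof.
have e : m.-2.+1 = m.-1 by move: m_ge6; clear; lia.
by apply: c_up; rewrite ?e //; [move: lt_mn; clear; lia | apply: cW c22 _ _ _; clear; lia].
Qed.
Let c12 := star_1_2.

(** Put [z = [~ t, h]], in [gam m.-2]. Modulo [gam m.+2] the element [[~ z, t]] is central, so
    conjugating [t ^+ 5] by [h] gives [t ^+ 5 * z ^+ 5 * [~ z, t] ^+ 10], and the last two factors
    vanish. *)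
Lemma star_fifth_power t h : 6 < m -> t \in gam 2 -> h \in gam 1 -> [~ t ^+ 5, h] \in L m.+2.
Proof.
move=> m7 t2 h1; have [s sG nsA] := exists_outer.
have p5 := fifth_power_in n_ge3 oG clG nAG iA dc dcd sG nsA.
have [tG hG] := (subsetP (gam_sub _) _ t2, subsetP (gam_sub _) _ h1).
pose z := [~ t, h]; have zm : z \in gam m.-2.
  rewrite [gam m.-2]gamE; last by move: m_ge6; clear; lia.
  exact: c_in (comm_leC c12) t2 h1.
have zG := subsetP (gam_sub _) _ zm.
pose q := coset (gam m.+2).
have qN x : x \in G -> x \in 'N(gam m.+2) by apply: subsetP (gam_norm _) x.
have ztm : [~ z, t] \in gam m.+1.
  rewrite [gam m.+1]gamE; last by move: m_ge6; clear; lia.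
  rewrite -groupV invg_comm.
  by apply: c_in t2 zm; apply: cW c24 _ _ _; move: m_ge6; clear; lia.
have central x y : x \in gam m.+1 -> y \in G -> commute (q x) (q y).
  move=> xm yG; have xG := subsetP (gam_sub _) _ xm.
  apply/commgP/eqP; rewrite -morphR ?qN //; apply: coset_id.
  by apply: (comm_outer_in p_pr nAG iA).
have q1 x : x \in gam m.+2 -> q x = 1 by apply: coset_id.
have E : q (t ^+ 5) ^ q h = q (t ^+ 5).
  rewrite -morphJ ?qN ?groupX // conjXg conjg_mulR -/z morphX ?(qN _ (groupM tG zG)) //.
  rewrite morphM ?qN // expMg_Rmul -?morphR ?qN //; last 2 first.
  - by apply/commute_sym/central.
  - by apply/commute_sym/central.
  have ztG : [~ z, t] \in G := subsetP (gam_sub _) _ ztm.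
  rewrite -!morphX ?qN //= -/q (q1 (z ^+ 5)); last first.
    by apply: in_gam_leq (p5 _ _ _ zm); move: m_ge6; clear; lia.
  rewrite (_ : 'C(5, 2) = 5 * 2)%N // [_ ^+ (5 * 2)]expgM.
  rewrite mulg1 (q1 (_ ^+ 5 ^+ 2)) ?mulg1 // groupX //.
  by apply: in_gam_leq (p5 _ _ _ ztm); move: m_ge6; clear; lia.
suffices h0 : [~ t ^+ 5, h] \in gam m.+2 by exact: h0.
apply: coset_idr; first by rewrite qN // groupR ?groupX.
by rewrite morphR ?qN ?groupX //; apply/eqP/conjg_fixP.
Qed.

(** Descending induction on [i]: from [m] on the degree of commutativity suffices; below, [gam i] is
    generated over [gam i.+1] by a fifth power from [gam (i - 4)]. *)
Lemma star_1_6 i : 6 < m -> 5 < i -> c i 1 m.+2.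
Proof.
move=> m7; have [s sG nsA] := exists_outer.
have p5 := fifth_power_in n_ge3 oG clG nAG iA dc dcd sG nsA.
have np5 := fifth_power_notin n_ge3 oG clG nAG iA dc dcd sG nsA.
have [d] := ubnP (m - i); elim: d i => // d IHd i le_d i6.
have i0 : 0 < i := leq_ltn_trans (leq0n 5) i6.
have [le_mi | lt_im] := leqP m i.
  by apply: cW (dc i0 (ltnSn 0)) _ _ _; rewrite ?addn1.
have i4 : 0 < i - 4 by rewrite subn_gt0 ltnW.
have e4 : (i - 4 + 4 = i)%N by rewrite subnK // ltnW // ltnW.
have e5 : (i - 4 + 5 = i.+1)%N by rewrite addnS e4.
have i41 : 1 < i - 4 by rewrite ltn_subRL.
have lt_in : i < n by apply: leq_trans lt_im (leq_trans _ lt_mn); rewrite ltnW.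
have [t ti nti] : exists2 t, t \in gam (i - 4) & t \notin gam (i - 4).+1.
  by apply: exists_gam_gen; rewrite i4 (leq_ltn_trans (leq_subr 4 i)).
have t2 : t \in gam 2 := in_gam_leq i41 ti.
apply: (c_gen (x := t ^+ 5)) => //.
- by rewrite -[X in gam X]e4; apply: p5 ti.
- rewrite -e5; apply: np5 => //; first by rewrite e4.
  (* For [j = i - 4], [fifth_power_notin] asks for [[~: gam j, gam j]] in [L (j + 5)]. From [j = 3]
     on this is [dcd]; for [j = 2] it is [c22], as [m] is at least 7. *)
  have [i6' | ne6] := eqVneq i 6; first by rewrite i6'; apply: cW c22 _ _ _.
  apply: cW (dcd i41) _ _ _ => //.
  by move: i6 ne6; clear; lia.
- by apply: IHd; [move: le_d lt_im; clear; lia | apply: ltnW].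
by move=> h h1; apply: star_fifth_power.
Qed.

(** The bound on [[~: gam 6, gam 1]] moves to [[~: gam 5, gam 2]] and then to [[~: gam 4, gam 3]].
    This is enough because [gam 3] is generated over [gam 4] by a single element, which commutes
    with itself. *)
Lemma star_3_3 : 6 < m -> c 3 3 m.+2.
Proof.
move=> m7; have c52 : c 5 2 m.+2.
  by apply: c_step => //; [apply: comm_leC | apply: star_1_6].
have c43 : c 4 3 m.+2 by apply: c_step => //; apply: comm_leC.
have [x x3 nx4] : exists2 x, x \in gam 3 & x \notin gam 4.
  by apply: exists_gam_gen; apply: leq_trans n_ge7.
have xG := subsetP (gam_sub _) _ x3.
apply: (c_gen _ x3 nx4) => // y y3; rewrite -groupV invg_comm.
apply: (comm_gen_left _ x3 nx4 xG _ _ y3) => //.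
  by rewrite (eqP (introT commgP (commute_refl x))) group1.
by move=> z z4; apply: c_in c43 z4 x3.
Qed.

Section NotNormallyMonomial.
Hypothesis nc22 : ~~ c 2 2 m.+1.
Hypothesis c33' : c 3 3 m.+2.

Let c25 : c 2 5 m.+2.
Proof. by apply: c_step => //; apply: cW c33' _ _ _. Qed.
Let c15' : c 1 5 m.+2. Proof. exact: comm_le_1_5. Qed.

Variables s g : gT.
Hypotheses (sG : s \in G) (nsA : s \notin A) (gA : g \in A) (ng2 : g \notin gam 2).

Let gG : g \in G. Proof. exact: (subsetP (normal_sub nAG)). Qed.
Let it_in i : itcomm s g i \in gam i.+1.
Proof. by have := itcomm_in nAG iA sG i (ltn0Sn 0) (gA : g \in gam 1). Qed.
Let it_notin i : i.+1 < n -> itcomm s g i \notin gam i.+2.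
Proof.
by move=> lt_n; apply: (itcomm_notin n_ge3 oG clG nAG iA dc sG nsA (ltn0Sn 0) _ (gA : g \in gam 1)).
Qed.
Local Notation q := (coset (gam m.+2)).
Let inG i x : x \in gam i -> x \in G. Proof. exact: (subsetP (gam_sub i)). Qed.
Let qN x : x \in G -> x \in 'N(gam m.+2). Proof. by apply: subsetP (gam_norm _) x. Qed.
Let q1 x : x \in gam m.+2 -> q x = 1. Proof. exact: coset_id. Qed.
Let q1P x : x \in G -> q x = 1 -> x \in gam m.+2.
Proof. by move=> xG; apply: coset_idr; apply: qN. Qed.
Let c_commute i j x y : c i j m.+2 -> x \in gam i -> y \in gam j -> commute (q x) (q y).
Proof.
move=> cij xi yj; have [xG yG] := (inG xi, inG yj).
by apply/commgP/eqP; rewrite -morphR ?qN //; apply: q1; apply: c_in cij xi yj.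
Qed.
Let dc_commute i j x y : 0 < i -> 0 < j -> m.+1 <= i + j ->
  x \in gam i -> y \in gam j -> commute (q x) (q y).
Proof.
by move=> i0 j0 le_m; apply: c_commute; apply: cW (dc i0 j0) _ _ _.
Qed.
Let gamEi i x : 1 < i -> (x \in L i) = (x \in gam i).
Proof. by move=> i1; rewrite [gam i]gamE. Qed.
Let n4 : 3 < n. Proof. exact: leq_trans n_ge7. Qed.
Let n3 : 2 < n. Proof. exact: ltnW n4. Qed.
Let m_gt1 : 1 < m. Proof. exact: leq_ltn_trans m_ge6. Qed.
Let m_gt0 : 0 < m. Proof. exact: ltnW m_gt1. Qed.
Let m1 : 1 < m.-1. Proof. by move: m_ge6; clear; lia. Qed.
Let m0 : 0 < m.-1. Proof. exact: ltnW. Qed.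
Let mm1 : (m.-1 + 2 = m.+1)%N. Proof. by move: m_ge6; clear; lia. Qed.
Let e := [~ itcomm s g 2, g].
Let f := [~ itcomm s g 3, g].
Let h := [~ itcomm s g 2, itcomm s g 1].
Let z := [~ itcomm s g 3, itcomm s g 1].
Let eL : e \in gam m.-1.
Proof. by rewrite -gamEi //; apply: c_in (comm_leC star_1_3) (it_in 2) gA. Qed.
Let fL : f \in gam m.
Proof. by rewrite -gamEi //; apply: c_in (comm_leC c14) (it_in 3) gA. Qed.
Let hL : h \in gam m.
Proof.
have i2 : itcomm s g 2 \in gam 2 := in_gam_leq (leqnSn 2) (it_in 2).
rewrite -(gamEi _ m_gt1); exact: c_in c22 i2 (it_in 1%N).
Qed.
Let zL : z \in gam m.+1.
Proof. rewrite -(gamEi _ (leqW m_gt1)); exact: c_in (comm_leC c24) (it_in 3) (it_in 1%N). Qed.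

Lemma star_relations :
  [/\ q h ^ q s = q h * q z, q f ^ q s = q z * q f & q e ^ q s = q h * q z * (q e * q f)].
Proof.
have itG i : itcomm s g i \in G := inG (it_in i).
have sit i : q (itcomm s g i) ^ q s = q (itcomm s g i) * q (itcomm s g i.+1).
  by rewrite -morphJ ?qN // conjg_mulR morphM ?qN // groupR.
have -> : q e = [~ q (itcomm s g 2), q g] by rewrite -morphR ?qN.
have -> : q f = [~ q (itcomm s g 3), q g] by rewrite -morphR ?qN.
have -> : q h = [~ q (itcomm s g 2), q (itcomm s g 1)] by rewrite -morphR ?qN.
have -> : q z = [~ q (itcomm s g 3), q (itcomm s g 1)] by rewrite -morphR ?qN.
apply: (@comm_shift_relations _ _ _ _ _ _ (q (itcomm s g 4))).
- exact: sit 0%N.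
- exact: sit 1%N.
- exact: sit 2.
- exact: sit 3.
all: rewrite -?morphR ?qN //.
- by apply: c_commute (it_in 2) (it_in 3); apply: cW c33' _ _ _.
- exact: c_commute (comm_leC c25) (it_in 4) (it_in 1%N).
- exact: c_commute (comm_leC c15') (it_in 4) gA.
- by apply: dc_commute hL (it_in 2) => //; rewrite -addn1 leq_add2l.
- by apply: dc_commute hL (it_in 3) => //; rewrite -addn1 leq_add2l.
- by apply: dc_commute zL (it_in 2) => //; rewrite leq_addr.
- by apply: dc_commute zL (it_in 4) => //; rewrite leq_addr.
- by apply: dc_commute fL (it_in 4) => //; rewrite -addn1 leq_add2l.
- by apply: dc_commute fL (it_in 1%N) => //; rewrite -addn1 leq_add2l.
- by apply: dc_commute eL (it_in 3) => //; rewrite -mm1 leq_add2l.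
- by apply: dc_commute eL (it_in 1%N) => //; rewrite -mm1 leq_add2l.
Qed.

Let lt_m1n : m.+1 < n. Proof. exact: lt_mn. Qed.
Let hG : h \in G. Proof. exact: inG hL. Qed.
Let zG : z \in G. Proof. exact: inG zL. Qed.
Let eG : e \in G. Proof. exact: inG eL. Qed.
Let fG : f \in G. Proof. exact: inG fL. Qed.
Let qJ x y : x \in G -> y \in G -> q x ^ q y = q (x ^ y).
Proof. by move=> xG yG; rewrite morphJ ?qN. Qed.
Let qM x y : x \in G -> y \in G -> q (x * y) = q x * q y.
Proof. by move=> xG yG; rewrite morphM ?qN. Qed.
Let qE x k : x \in G -> q (x ^+ k) = q x ^+ k.
Proof. by move=> xG; rewrite morphX ?qN. Qed.
Let q_outer x i : 0 < i -> i <= m -> x \in gam i -> x \notin gam i.+1 -> [~ x, s] \notin gam i.+2.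
Proof.
move=> i0 le_im; apply: (comm_outer p_pr n_ge3 oG clG nAG iA dc sG nsA i0).
exact: leq_ltn_trans lt_m1n.
Qed.

(** [gam 2] is generated over [gam 4] by [itcomm s g 1] and [itcomm s g 2]; given [c24] and [c33],
    their commutator [h] alone decides the bound denied by [nc22]. *)
Lemma star_h_notin : h \notin gam m.+1.
Proof.
apply: contra nc22 => hL1; have ni2 := it_notin n4; have ni1 := it_notin n3.
have i2 := it_in 2; have i1 := it_in 1%N; have [i2G i1G] := (inG i2, inG i1).
have c32 : c 3 2 m.+1.
  apply: (c_gen (i := 3) _ i2 ni2) => //; first exact: comm_leC c24.
  move=> y y2; rewrite -groupV invg_comm.
  apply: (comm_gen_left (i := 2) _ i1 ni1 i2G) y2 => //.
    by rewrite -groupV invg_comm gamEi.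
  by move=> x x3; apply: c_in c33 x3 i2.
apply: (c_gen (i := 2) _ i1 ni1) => // y y2; rewrite -groupV invg_comm.
apply: (comm_gen_left (i := 2) _ i1 ni1 i1G) y2 => //.
  by rewrite (eqP (introT commgP (commute_refl _))) group1.
by move=> x x3; apply: c_in c32 x3 i1.
Qed.

Let qh : q h ^ q s = q h * q z. Proof. by have [] := star_relations. Qed.
Let qf : q f ^ q s = q z * q f. Proof. by have [] := star_relations. Qed.
Let qe : q e ^ q s = q h * q z * (q e * q f). Proof. by have [] := star_relations. Qed.

(** Otherwise [s] would fix [h] modulo [gam m.+2], against [comm_outer]. *)
Lemma star_z_neq1 : q z != 1.
Proof.
apply/eqP=> z1; have := star_h_notin.
move/(q_outer m_gt0 (leqnn m) hL)/negP; apply.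
apply: q1P; first by rewrite groupR.
by rewrite morphR ?qN //; apply/eqP/conjg_fixP; rewrite qh z1 mulg1.
Qed.

(** The relation for [f] makes [[~ f, s]] congruent to [z], which is nontrivial. *)
Lemma star_f_notin : f \notin gam m.+1.
Proof.
apply/negP=> f1; have /negP[] := star_z_neq1; apply/eqP.
have fs : [~ f, s] \in gam m.+2 by apply: (comm_outer_in p_pr nAG iA).
have: q [~ f, s] = 1 := q1 fs.
rewrite morphR ?qN // => /eqP/conjg_fixP; rewrite qf => /(canRL (mulgK _)).
by rewrite mulgV.
Qed.

Let p5 i x : 1 < i -> m.+2 <= i + 4 -> x \in gam i -> q x ^+ 5 = 1.
Proof.
move=> i1 le_m xi; have xG := inG xi; rewrite -morphX ?qN //; apply: q1.
by apply: in_gam_leq (fifth_power_in n_ge3 oG clG nAG iA dc dcd sG nsA i1 xi).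
Qed.

Let central x y : x \in gam m.+1 -> y \in G -> commute (q x) (q y).
Proof.
move=> x1 yG; have xG := inG x1.
apply/commgP/eqP; rewrite -morphR ?qN //; apply: q1.
exact: (comm_outer_in p_pr nAG iA).
Qed.

(** If [e] were in [gam m], then [[~ e, s]], congruent to [h * z * f], would be central modulo
    [gam m.+2]. But [s] multiplies [h * z * f] by [z ^+ 2], and [z ^+ 5] is trivial there, so [z]
    would be too. *)
Lemma star_e_notin : e \notin gam m.
Proof.
apply/negP=> e1; have /negP[] := star_z_neq1; apply/eqP.
have es : [~ e, s] \in gam m.+1.
  by apply: (comm_outer_in p_pr nAG iA) => //; apply: ltnW.
have czs := central zL sG; have czh := central zL hG; have czf := central zL fG.
have che : commute (q h) (q e) by apply: dc_commute hL eL; rewrite ?leq_addr //; move: m_ge6; clear; lia.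
have cze := central zL eG.
have Dres : q [~ e, s] = q h * q z * q f.
  have c_ehz : commute (q e) (q h * q z) by apply: commuteM; apply: commute_sym.
  have -> : q [~ e, s] = (q e)^-1 * (q h * q z * (q e * q f)).
    by rewrite morphR ?qN // commgEl qe.
  by rewrite (mulgA (q h * q z)) -c_ehz !mulgA mulVg mul1g.
have := central es sG; rewrite Dres => /commgP/conjg_fixP.
rewrite !conjMg qh qf /= (_ : q z ^ q s = q z); last exact/conjg_fixP/commgP.
rewrite -!mulgA => /mulgI/mulgI; rewrite !mulgA => /(canRL (mulgK _)).
rewrite mulgV => zz.
have le5 : m.+2 <= m.+1 + 4 by rewrite addSn ltnS -addn1 leq_add2l.
have := p5 (leqW m_gt1) le5 zL; by rewrite !expgS expg0 mulg1 !mulgA zz mul1g zz mul1g.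
Qed.

Lemma gam_decomp i x y : 0 < i -> x \in gam i -> x \notin gam i.+1 -> y \in gam i ->
  exists k u, u \in gam i.+1 /\ y = x ^+ k * u.
Proof.
move=> i0 xi nxi yi; have xG := inG xi.
have nxg : <[x]> \subset 'N(gam i.+1) by rewrite cycle_subG (subsetP (gam_norm _)).
have := subsetP (gam_gen i0 xi nxi _ (joing_subr <[x]> (gam i.+1))) y yi.
rewrite (subsetP (joing_subl _ _)) ?cycle_id // => /(_ isT).
rewrite /= norm_joinEl // => /mulsgP[_ u /cycleP[k ->] ui ->].
by exists k, u.
Qed.

Lemma gam_expg_dvd i x k : 0 < i -> i < n -> x \in gam i -> x \notin gam i.+1 ->
  x ^+ k \in gam i.+1 -> 5 %| k.
Proof.
move=> i0 lt_in xi nxi xk; have xG := inG xi.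
have xN : x \in 'N(gam i.+1) by apply: (subsetP (gam_norm _)).
have: #[coset (gam i.+1) x] %| k by rewrite order_dvdn -morphX //; apply/eqP/coset_id.
have: #[coset (gam i.+1) x] %| 5.
  have -> : 5 = #|gam i / gam i.+1|.
    rewrite card_quotient ?(gam_index p_pr n_ge3 oG clG nAG iA) ?i0 //.
    by rewrite (subset_trans (gam_sub i)).
  by apply: order_dvdG; apply: mem_quotient.
move/(primeP p_pr).2/orP=> [|/eqP->//]; rewrite order_eq1 => /eqP/coset_idr-/(_ xN).
by rewrite (negPf nxi).
Qed.

(** Decomposing [b] along [gam 3], [gam 4], [gam 5] gives [[~ b, g]] congruent to [e ^+ i * f ^+ j].
    As [e] and [f] lie exactly in [gam m.-1] and [gam m], 5 divides [i], then [j]; and fifth powers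
    of [e] and [f] are trivial modulo [gam m.+2]. *)
Lemma star_no_commutator b :
  b \in gam 3 -> [~ b, g] \in L m.+1 -> [~ b, g] \in L m.+2.
Proof.
move=> b3 bg; have [i2 i3] := (it_in 2, it_in 3).
have n5 : 4 < n := leq_trans (isT : 4 < 7) n_ge7.
have bD : exists i j, q [~ b, g] = q (e ^+ i * f ^+ j).
  have [i [u [u4 Db]]] := gam_decomp (isT : 0 < 3) i2 (it_notin n4) b3.
  have [j [v [v5 Du]]] := gam_decomp (isT : 0 < 4) i3 (it_notin n5) u4.
  exists i, j.
  have qR x y : x \in gam 3 -> y \in gam 3 -> q [~ x * y, g] = q [~ x, g] * q [~ y, g].
    move=> x3 y3; have [xG yG] := (inG x3, inG y3).
    rewrite commMgJ qM ?groupJ ?groupR // -qJ ?groupR //; congr (_ * _).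
    apply/conjg_fixP/commgP; apply: c_commute c33' _ y3.
    by apply: in_gam_leq (comm_outer_in p_pr nAG iA gG (ltn0Sn 2) x3).
  have qX x k l r : m.+1 <= k.+1 + l.+1 -> x \in gam k.+1 -> [~ x, g] \in gam l.+1 ->
      q [~ x ^+ r, g] = q [~ x, g] ^+ r.
    move=> le_m xk xg; have xG := inG xk.
    rewrite morphR ?qN ?groupX // morphX ?qN // commXg -?morphR ?qN //.
    exact: dc_commute xk xg.
  have [v1 v3] : q [~ v, g] = 1 /\ v \in gam 3.
    split; last exact: in_gam_leq v5.
    by apply: q1; rewrite -gamEi //; apply: c_in (comm_leC c15') v5 gA.
  have s3 : itcomm s g 3 ^+ j \in gam 3 by rewrite groupX // (in_gam_leq _ i3).
  have u3 : u \in gam 3 by apply: in_gam_leq u4.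
  rewrite Db qR ?groupX // Du qR // v1 mulg1.
  rewrite (qX (itcomm s g 2) 2 m.-2) ?(qX (itcomm s g 3) 3 m.-1) //.
  - have [eiG fjG] := (groupX i eG, groupX j fG).
    by rewrite (qM eiG fjG) (qE i eG) (qE j fG).
  - by rewrite addSn ltnS (prednK m_gt0) leq_addl.
  - by rewrite (prednK m_gt0).
  - by rewrite -[m.-2.+1]/(m.-1.-1.+1) (prednK m0) addnC -mm1 leq_add2l.
  by rewrite -[m.-2.+1]/(m.-1.-1.+1) (prednK m0).
have [i [j Dij]] := bD.
have efG : e ^+ i * f ^+ j \in G by rewrite groupM ?groupX.
have bgG : [~ b, g] \in G by rewrite groupR // (inG b3).
have efm1 : e ^+ i * f ^+ j \in gam m.+1.
  have bg' : [~ b, g] \in gam m.+1 by rewrite -gamEi.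
  rewrite -(groupMl _ (groupVr bg')); apply: (in_gam_leq (leqnSn _)); apply: q1P.
    by rewrite groupM ?groupV.
  by rewrite qM ?groupV // morphV ?qN //= -Dij mulVg.
have fj : f ^+ j \in gam m by rewrite groupX.
have ei : e ^+ i \in gam m.
  by rewrite -(groupMr _ fj); apply: in_gam_leq efm1.
have lt_mn' : m < n := ltnW lt_m1n.
have e1 : q (e ^+ i) = 1.
  have /dvdnP[k ->] : 5 %| i.
    apply: (gam_expg_dvd m0 _ eL); rewrite ?(prednK m_gt0) ?star_e_notin //.
    exact: ltnW lt_mn'.
  have le5 : m.+2 <= m.-1 + 4 by rewrite -[4]/(2 + 2)%N addnA mm1 addn2.
  by rewrite mulnC expgM !qE ?groupX // (p5 m1 le5 eL) expg1n.
have f1 : q (f ^+ j) = 1.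
  have /dvdnP[k ->] : 5 %| j.
    apply: (gam_expg_dvd m_gt0 lt_mn' fL star_f_notin).
    rewrite -(groupMl _ (_ : e ^+ i \in gam m.+1)) //.
    by apply: (in_gam_leq (leqnSn _)); apply: q1P; rewrite ?groupX.
  have le5 : m.+2 <= m + 4 by rewrite -addn2 leq_add2l.
  by rewrite mulnC expgM !qE ?groupX // (p5 m_gt1 le5 fL) expg1n.
rewrite gamEi //; apply: q1P => //.
by rewrite Dij qM ?groupX // e1 f1 mulg1.
Qed.

End NotNormallyMonomial.
End Star.
End SecondTermCommutators.

(** * Degrees *)

Section Stabilizer.
Local Open Scope group_scope.

Lemma Inertia_commg (gT : finGroupType) (G B : {group gT}) (j : Iirr B) g :
    B <| G -> 'chi_j \is a linear_char -> g \in G ->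
    {in B, forall x, [~ x, g] \in cfker 'chi_j} -> g \in 'I_G['chi_j].
Proof.
move=> nBG linj gG kg; have nBg := subsetP (normal_norm nBG) g gG.
rewrite inE gG inE nBg /=; apply/eqP/cfun_inP=> x xB.
rewrite cfConjgE //; have x'B : x ^ g^-1 \in B by rewrite memJ_norm ?groupV.
have kx := kg _ x'B; have [k1 k2] := (kx, subsetP (cfker_sub _) _ kx).
have Dx : x = x ^ g^-1 * [~ x ^ g^-1, g] by rewrite -conjg_mulR conjgKV.
by rewrite [in RHS]Dx (lin_charM linj x'B k2) (cfker1 kx) (lin_char1 linj) GRing.mulr1 //.
Qed.

(** As [B / M] is abelian, the values [[~ b, g]] form a subgroup [K] modulo [M], and it meets [C]
    only in [M]. A linear character of [B] trivial on [K] but not on [C] is fixed by [g]. *)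
Lemma exists_fixed_lin_char (gT : finGroupType) (G B M C : {group gT}) g :
    B <| G -> M <| G -> M \subset C -> C \subset B -> g \in G -> B^`(1) \subset M ->
    ~~ (C \subset M) ->
    {in B, forall b, [~ b, g] \in C -> [~ b, g] \in M} ->
  exists j : Iirr B, [/\ 'chi_j \is a linear_char, M \subset cfker 'chi_j,
     ~~ (C \subset cfker 'chi_j) & g \in 'I_G['chi_j]].
Proof.
move=> nBG nMG sMC sCB gG derB nsCM noC.
have sMB := subset_trans sMC sCB; have [sBG nBG'] := andP nBG; have [sMG nMG'] := andP nMG.
have bg b : b \in B -> [~ b, g] \in B.
  by move=> bB; rewrite groupM ?groupV // memJ_norm // (subsetP nBG').
have qN x : x \in B -> x \in 'N(M) by move=> xB; rewrite (subsetP nMG') // (subsetP sBG).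
pose K := [set x in B | [exists b in B, coset M x == coset M [~ b, g]]].
have comm x y : x \in B -> y \in B -> commute (coset M x) (coset M y).
  move=> xB yB; apply/commgP/eqP; rewrite -morphR ?qN //; apply: coset_id.
  by apply: (subsetP derB); apply: mem_commg.
have gK : group_set K.
  apply/group_setP; split.
    by rewrite inE group1; apply/exists_inP; exists 1; rewrite ?group1 // comm1g.
  move=> x y /setIdP[xB /exists_inP[b bB /eqP xb]] /setIdP[yB /exists_inP[d dB /eqP yd]].
  rewrite inE groupM //; apply/exists_inP; exists (b * d); first exact: groupM.
  have [bgB dgB] := (bg b bB, bg d dB); have bgdB : [~ b, g] ^ d \in B by rewrite groupJ.
  rewrite commMgJ (morphM _ (qN _ xB) (qN _ yB)) (morphM _ (qN _ bgdB) (qN _ dgB)) /= xb yd.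
  rewrite (morphJ _ (qN _ bgB) (qN _ dB)) /= (_ : _ ^ _ = coset M [~ b, g]) //.
  by apply/conjg_fixP/commgP/comm.
have sMK : M \subset Group gK.
  apply/subsetP=> x xM; rewrite inE (subsetP sMB) //; apply/exists_inP.
  by exists 1; rewrite ?group1 // comm1g morph1 coset_id.
have nKB : Group gK <| B.
  rewrite sub_der1_normal ?(subset_trans derB) //.
  by apply/subsetP=> x /setIdP[].
have nsCK : ~~ (C \subset Group gK).
  apply: contra nsCM => sCK; apply/subsetP=> x xC.
  have /setIdP[xB /exists_inP[b bB /eqP xb]] := subsetP sCK x xC.
  have xb1 : x^-1 * [~ b, g] \in M.
    apply: coset_idr; first by rewrite qN // groupM ?groupV // bg.
    have bB' := bg b bB; rewrite (morphM _ (qN _ (groupVr xB)) (qN _ bB')) (morphV _ (qN _ xB)) /= xb.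
    exact: mulVg.
  have bgM : [~ b, g] \in M.
    by apply: noC => //; rewrite -(mulKVg x [~ b, g]); apply: groupM xC (subsetP sMC _ xb1).
  by rewrite -groupV -(groupMr _ bgM).
have [j [kK kC]] := exists_irr_separating nKB sCB nsCK.
have linj : 'chi_j \is a linear_char.
  by rewrite lin_irr_der1 (subset_trans derB) ?(subset_trans sMK).
exists j; split=> //; first exact: subset_trans kK.
apply: Inertia_commg => // x xB; apply: (subsetP kK).
by rewrite inE bg //; apply/exists_inP; exists x.
Qed.

End Stabilizer.

Section MaxClassNormallyMonomial.
Local Open Scope nat_scope.
Local Open Scope group_scope.
Variables (gT : finGroupType) (G : {group gT}) (n : nat).
Hypotheses (n_ge3 : 2 < n) (oG : #|G| = (5 ^ n)%N) (clG : nil_class G = n.-1).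
Hypothesis nmG : normally_monomial G.
Local Notation L i := 'L_i(G).

Let p_pr : prime 5. Proof. by []. Qed.

Lemma nm_no_fixed m g : m.+2 <= n -> 2 < m -> g \in G -> g \notin L 3 ->
    ~~ ([~: L 2, L 2] \subset L m.+2) -> [~: L 3, L 3] \subset L m.+2 ->
  exists2 b, b \in L 3 & ([~ b, g] \in L m.+1) && ([~ b, g] \notin L m.+2).
Proof.
move=> lt_mn m3 gG ng3 n22 c33.
have m2 : 2 < m.+2 <= n by rewrite lt_mn andbT ltnS ltnW // ltnW.
apply/exists_inP; apply: contraR ng3; rewrite negb_exists_in => /forall_inP no.
have nL3 := lcn_normal 3 G.
have s13 : L m.+1 \subset L 3 by apply: lcn_sub_leq; apply: leqW.
have [j [linj kj ncj fix_j]] : exists j : Iirr 'L_3(G), [/\ 'chi_j \is a linear_char,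
    L m.+2 \subset cfker 'chi_j, ~~ (L m.+1 \subset cfker 'chi_j) & g \in 'I_G['chi_j]].
  apply: exists_fixed_lin_char => //.
  - exact: lcn_normal.
  - exact: lcn_subS.
  - by have := mc_lcn_proper p_pr n_ge3 oG clG (lt_mn : 0 < m.+1 < n); rewrite properE => /andP[].
  by move=> b b3 bg; have := no b b3; rewrite bg /= negbK.
have [i ij] := constt_cfInd_irr j (lcn_sub 3 G).
have lev : L m.+2 \subset cfker 'chi_i /\ ~~ (L m.+1 \subset cfker 'chi_i).
  split.
    apply: subset_trans (cfker_constt (cfInd_char G (irr_char j)) ij).
    by rewrite cfker_Ind_irr ?lcn_sub // gcore_max // lcn_norm.
  apply: contra ncj => sub; rewrite constt_Ind_Res in ij.
  apply: subset_trans (cfker_constt (cfRes_char _ (irr_char i)) ij).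
  by rewrite cfker_Res ?irr_char ?lcn_sub // subsetI s13.
have [k [B [nBG iB km derB deg]]] := nm_level p_pr n_ge3 oG clG nmG m2.
have i3 : #|G : L 3| = (5 ^ 3)%N.
  rewrite -divgS ?lcn_sub // oG (mc_card_lcn p_pr n_ge3 oG clG) //.
  by rewrite -expnB ?leq_subr // subKn.
(* [L 3] is abelian modulo [L m.+2] and bounds the degree above; an inducing subgroup of index at
   most [5 ^ 2] would contain [L 2], which is not abelian modulo [L m.+2]. *)
have k3 : k = 3.
  apply/eqP; rewrite eqn_leq; apply/andP; split.
    rewrite -(@leq_exp2l 5) // -i3 -(ler_nat algC) -(deg _ lev).
    by apply: irr1_le_index => //; apply: subset_trans c33 lev.1.
  rewrite ltnNge; apply: contra n22 => k2.
  have := mc_normal_index p_pr n_ge3 oG clG nBG iB; rewrite (maxn_idPl k2) => sub.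
  by apply: subset_trans derB; apply: commgSS.
have degi : 'chi_i 1%g = #|G : L 3|%:R :> algC by rewrite (deg _ lev) i3 k3.
by apply: subsetP fix_j; apply: Inertia_full_degree ij degi.
Qed.

Lemma nm_lcn3_abelian : [~: L 3, L 3] = 1.
Proof.
have dL k : 1 < k -> [~: L k, L k] \subset L k.*2.+2 := nm_lcn_der1 p_pr n_ge3 oG clG nmG (k := k).
(* For small [n] the a priori bound [L 8] on [[~: L 3, L 3]] is already trivial. *)
have [le_n8 | lt_8n] := leqP n 8.
  apply/trivgP; apply: subset_trans (dL 3 isT) _.
  by rewrite (mc_lcn_triv p_pr n_ge3 oG clG).
have [A [nAG iA derA]] := nm_maximal_subgroup p_pr n_ge3 oG clG nmG (ltnW (ltnW (ltnW (ltnW (ltnW lt_8n))))).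
have n7 : 6 < n by apply: ltnW (ltnW _).
have dc := comm_le_sum p_pr n_ge3 oG clG nAG iA derA dL.
have dcd i : 1 < i -> comm_term_le G A i i i.*2.+2 by case: i => [|[|i]] //; apply: dL.
have key k : 5 < k -> k < n ->
    comm_term_le G A 2 2 k /\ comm_term_le G A 3 3 k.+1.
  elim: k => // k IHk k6 lt_kn; have [-> | ne_k5] := eqVneq k 5.
    split; first exact: dL 2 isT.
    by apply: subset_trans (dL 3 isT) _; apply: lcn_sub_leq.
  have k6' : 5 < k by rewrite ltn_neqAle eq_sym ne_k5.
  have [c22 c33] := IHk k6' (ltnW lt_kn).
  have c33' : comm_term_le G A 3 3 k.+2.
    (* [star_3_3] starts at [k = 7]; for [k = 6] the bound is again the a priori one. *)
    have [k7 | ne_k6] := eqVneq k 6; first by rewrite k7; apply: dL.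
    apply: (star_3_3 n7 oG clG nAG iA dc dcd lt_kn k6' c22 c33).
    by rewrite ltn_neqAle eq_sym ne_k6.
  split=> //; case: (boolP (comm_term_le G A 2 2 k.+1)) => // nc22.
  have [s sG nsA] := exists_outer iA.
  have [g gA ng2] := exists_gam_gen p_pr n_ge3 oG clG nAG iA (ltnW n_ge3 : 0 < 1 < n).
  have gG : g \in G := subsetP (normal_sub nAG) g gA.
  have ng3 : g \notin L 3 by apply: contra ng2; apply: subsetP (lcn_subS 2 G) g.
  have n22 : ~~ ([~: L 2, L 2] \subset L k.+2).
    by apply: contra nc22 => /subset_trans; apply; apply: lcn_subS.
  have lt2k : 2 < k by apply: leq_trans k6'.
  have [b b3 /andP[b1 /negP[]]] := nm_no_fixed lt_kn lt2k gG ng3 n22 c33'.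
  exact: (star_no_commutator n7 oG clG nAG iA dc dcd lt_kn k6' c22 c33 nc22 c33' sG nsA gA ng2 b3 b1).
have n0 : 0 < n := ltn_trans (isT : 0 < 2) n_ge3.
have [_] : comm_term_le G A 2 2 n.-1 /\ comm_term_le G A 3 3 n.-1.+1.
  by apply: key; rewrite ?prednK // -ltnS prednK.
rewrite prednK // => c33; apply/trivgP.
by apply: subset_trans c33 _; rewrite (mc_lcn_triv p_pr n_ge3 oG clG).
Qed.

End MaxClassNormallyMonomial.

Section DegreeSets.
Variables (gT : finGroupType) (G : {group gT}).
Hypotheses (mcG : maximal_class 5 G) (nmG : normally_monomial G).

Lemma nm5_irr1 (i : Iirr G) :
  exists2 k, (k < 4)%N & 'chi_i 1%g = 5 ^+ k.
Proof.
have [p_pr [n [n3 oG clG]]] := mcG.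
have [B [lam [nBG linl Dchi]]] := nmG i.
have degB : 'chi_i 1%g = #|G : B|%g%:R.
  by rewrite Dchi cfInd1 ?normal_sub // (lin_char1 linl) mulr1.
have [k iB] : exists k, #|G : B|%g = (5 ^ k)%N.
  exists (logn 5 #|G : B|%g); rewrite -p_part part_pnat_id //.
  exact: pnat_dvd (dvdn_indexg G B) (mc_pgroup p_pr oG).
exists k; last by rewrite degB iB natrX.
have i3 : #|G : 'L_3(G)|%g = (5 ^ 3)%N.
  rewrite -divgS ?lcn_sub // oG (mc_card_lcn p_pr n3 oG clG) //.
  by rewrite -expnB ?leq_subr // subKn.
rewrite ltnS -(@leq_exp2l 5) // -iB -i3 -(ler_nat algC) -degB.
apply: irr1_le_index; first exact: lcn_normal.
by rewrite derg1 (nm_lcn3_abelian n3 oG clG nmG) sub1G.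
Qed.

(** Characters with kernel [L 3] have degree 1 or 5, and 1 would put the derived subgroup inside
    [L 3]. *)
Lemma nm5_irr1_5 : exists i : Iirr G, 'chi_i 1%g = 5.
Proof.
have [p_pr [n [n3 oG clG]]] := mcG.
have m3 : (2 < 3 <= n)%N by [].
have [i lev] := exists_level p_pr n3 oG clG m3.
have [k [B [nBG iB k3 derB deg]]] := nm_level p_pr n3 oG clG nmG m3.
exists i; rewrite (deg _ lev); case: k => [|[|//]] in iB k3 {deg} *; last by rewrite expn1.
move/eqP: iB; rewrite expn0 indexg_eq1 => sGB.
have := mc_lcn_proper p_pr n3 oG clG (n3 : (0 < 2 < n)%N).
by rewrite properE lcn2 (subset_trans (dergS 1 sGB) derB) andbF.
Qed.

Lemma cd1 : 1 \in cd G.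
Proof. by apply/imageP; exists 0; rewrite // irr0 cfun11. Qed.

Lemma nm5_cd :
  exists2 D : seq algC,
    D \in [:: [:: 1; 5]; [:: 1; 5; 5 ^+ 2]; [:: 1; 5; 5 ^+ 3];
        [:: 1; 5; 5 ^+ 2; 5 ^+ 3]] & cd G =i D.
Proof.
have c5 : 5 \in cd G by have [i <-] := nm5_irr1_5; apply: image_f.
have cdP x : x \in cd G -> [|| x == 1, x == 5, x == 5 ^+ 2 | x == 5 ^+ 3].
  case/imageP=> i _ ->; have [[|[|[|[|//]]]] _ ->] := nm5_irr1 i.
  - by rewrite expr0 eqxx.
  - by rewrite expr1 eqxx orbT.
  - by rewrite eqxx !orbT.
  - by rewrite eqxx !orbT.
exists ([:: 1; 5] ++ (if 5 ^+ 2 \in cd G then [:: 5 ^+ 2] else [::])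
        ++ (if 5 ^+ 3 \in cd G then [:: 5 ^+ 3] else [::])).
  by case: ifP => _; case: ifP => _; rewrite !inE eqxx ?orbT.
move=> x; apply/idP/idP.
  move=> xG; move: (cdP x xG); rewrite !mem_cat !inE.
  by case/or4P=> /eqP Dx; rewrite Dx ?eqxx ?orbT //; rewrite Dx in xG; rewrite xG inE eqxx ?orbT.
rewrite !mem_cat !inE -orbA => /or4P[/eqP->|/eqP->||] //; first exact: cd1.
  by case: ifP => //; rewrite inE => xG /eqP->.
by case: ifP => //; rewrite inE => xG /eqP->.
Qed.

End DegreeSets.

(** * Examples *)

Section Criterion.
Local Open Scope nat_scope.
Local Open Scope group_scope.
Variables (p : nat) (gT : finGroupType) (G : {group gT}) (n : nat).
Hypotheses (p_pr : prime p) (n_ge3 : 2 < n) (oG : #|G| = (p ^ n)%N).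
Hypothesis clG : nil_class G = n.-1.
Local Notation L i := 'L_i(G).
Variable B : nat -> {group gT}.
Hypothesis nBG : forall m, 2 < m <= n -> B m <| G.
Hypothesis derB : forall m, 2 < m <= n -> (B m)^`(1) \subset L m.
(** Whatever fixes a character fixes it together with all its powers, so a convenient power [h] of
    [g] may be tested instead. *)
Hypothesis commB : forall m g, 2 < m <= n -> g \in G -> g \notin B m ->
  exists h b, [/\ h \in <[g]>, b \in B m, [~ b, h] \in L m.-1 & [~ b, h] \notin L m].

(** A linear constituent of the restriction to [B m] is moved by every [g] outside [B m], because
    some [[~ b, h]] generates [L m.-1] over [L m] and cannot lie in its kernel. Its inertia group is
    thus [B m], and it induces irreducibly. *)
Lemma crit_level m (i : Iirr G) : 2 < m <= n ->
    L m \subset cfker 'chi_i -> ~~ (L m.-1 \subset cfker 'chi_i) ->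
  exists2 lam : 'CF(B m), lam \is a linear_char & 'chi_i = 'Ind[G] lam.
Proof.
move=> m3 kLm nkL; have nB := nBG m3; have [sBG nBG'] := andP nB.
have [m1n e1] : 0 < m.-1 < n /\ m.-1.+1 = m by move: m3; clear; lia.
have [j ij] := constt_cfRes_irr (B m) i.
have kres := cfker_constt (cfRes_char (B m) (irr_char i)) ij.
rewrite cfker_Res ?irr_char // in kres.
have sLk x : x \in B m -> x \in L m -> x \in cfker 'chi_j.
  by move=> xB xL; apply: (subsetP kres); rewrite inE xB (subsetP kLm).
have linj : 'chi_j \is a linear_char.
  rewrite lin_irr_der1; apply/subsetP=> x xd.
  by rewrite sLk ?(subsetP (derB m3)) // (subsetP (der_sub 1 (B m))).
have IB : 'I_G['chi_j] \subset B m.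
  apply/subsetP=> g /setIP[gG gI]; apply: contraT => ngB.
  have [h [b [hg bB bh1 bh2]]] := commB m3 gG ngB.
  have hG : h \in G by apply: subsetP hg; rewrite cycle_subG.
  have hI : h \in 'I['chi_j] by apply: subsetP hg; rewrite cycle_subG.
  have hN : h \in 'N(B m) by rewrite (subsetP nBG').
  have bhB : [~ b, h] \in B m by rewrite groupM ?groupV ?memJ_norm.
  have kbh : [~ b, h] \in cfker 'chi_j.
    have hJ : 'chi_j (b ^ h) = 'chi_j b.
      by move: hI; rewrite inE hN => /eqP hI; rewrite -{1}hI cfConjgEJ.
    have bhJ : b ^ h \in B m by rewrite memJ_norm.
    rewrite cfkerEirr inE commgEl (lin_charM linj (groupVr bB) bhJ) hJ.
    by rewrite lin_charV // (lin_char1 linj) mulVf ?lin_char_neq0.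
  (* Otherwise [B m] is contained in [L m], although it contains [[~ b, h]]. *)
  have sLB : L m.-1 \subset B m.
    have [sub | [k /andP[k2 kn] Dk]] := mc_normalP p_pr n_ge3 oG clG nB.
      by apply: subset_trans sub; apply: lcn_sub_leq; rewrite -ltnS e1; case/andP: m3.
    rewrite Dk lcn_sub_leq // leqNgt; apply: contra bh2 => lt_mk.
    rewrite Dk in bhB; apply: subsetP (lcn_sub_leq G _) _ bhB.
    by rewrite -e1.
  case/negP: nkL; rewrite -constt_Ind_Res in ij.
  apply: subset_trans (cfker_constt (cfInd_char G (irr_char j)) ij).
  rewrite cfker_Ind_irr // gcore_max ?lcn_norm //.
  apply: (prime_index_gen (N := 'L_m(G)%G) _ _ bh1 bh2 kbh).
  - by rewrite -{1}e1 lcn_subS.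
  - have i2 : 1 < m.-1 < n by move: m3 e1; clear; lia.
    by have := mc_lcn_index p_pr n_ge3 oG clG i2; rewrite e1 /= => ->.
  apply/subsetP=> x xL; apply: sLk => //; apply: (subsetP sLB).
  by rewrite -e1 in xL; apply: (subsetP (lcn_subS _ _)).
rewrite -constt_Ind_Res in ij.
have eqT : 'I_G['chi_j]%G = B m.
  by apply/val_inj/eqP; rewrite eqEsubset IB sub_Inertia.
have key (T : {group gT}) (s : Iirr T) : T = B m -> s \in irr_constt ('Ind[T] 'chi_j) ->
    'Ind[G] 'chi_s = 'Ind[G] 'chi_j.
  move=> DT; subst T; rewrite cfInd_id // irr_consttE cfdot_irr.
  by case: (eqVneq j s) => [-> // | _]; rewrite eqxx.
have [_ _ imT _ _] := constt_Inertia_bijection j nB.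
have [irrT _ _ _ _] := constt_Inertia_bijection j nB.
move: ij; rewrite -imT => /imsetP[s sA Di].
exists 'chi_j => //; rewrite Di /Ind_Iirr cfIirrE ?irrT //.
exact: key eqT sA.
Qed.

Lemma crit_cases (i : Iirr G) : 'chi_i \is a linear_char \/
  exists2 m, 2 < m <= n & L m \subset cfker 'chi_i /\ ~~ (L m.-1 \subset cfker 'chi_i).
Proof.
have exP : exists m, L m \subset cfker 'chi_i.
  by exists n; rewrite (mc_lcn_triv p_pr n_ge3 oG clG) ?sub1G.
case: (boolP ('chi_i \is a linear_char)) => [|nlin]; [by left | right].
have [m kLm minm] := ex_minnP exP.
have m3 : 2 < m.
  rewrite ltnNge; apply: contra nlin => le_m2; rewrite lin_irr_der1 -lcn2.
  exact: subset_trans (lcn_sub_leq G le_m2) kLm.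
exists m.
  by rewrite m3 minm // (mc_lcn_triv p_pr n_ge3 oG clG) ?sub1G.
by split=> //; apply/negP=> /minm; rewrite -ltnS prednK ?ltnn // (ltn_trans _ m3).
Qed.

Lemma crit_normally_monomial : normally_monomial G.
Proof.
move=> i; have [lin | [m m3 [kLm nkL]]] := crit_cases i.
  by exists G, 'chi_i; rewrite cfInd_id.
have [lam linl Dchi] := crit_level m3 kLm nkL.
by exists (B m), lam; rewrite nBG.
Qed.

Lemma crit_degree m (i : Iirr G) : 2 < m <= n ->
    L m \subset cfker 'chi_i -> ~~ (L m.-1 \subset cfker 'chi_i) ->
  'chi_i 1 = #|G : B m|%:R :> algC.
Proof.
move=> m3 kLm nkL; have [lam linl ->] := crit_level m3 kLm nkL.
by rewrite cfInd1 ?(normal_sub (nBG m3)) // (lin_char1 linl) GRing.mulr1.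
Qed.

Lemma crit_cdP x :
  x \in cd G <-> x = 1%R \/ exists2 m, 2 < m <= n & x = #|G : B m|%:R :> algC.
Proof.
split=> [/imageP[i _ ->] | [-> | [m m3 ->]]].
- have [lin | [m m3 [kLm nkL]]] := crit_cases i; first by left; rewrite (lin_char1 lin).
  by right; exists m => //; apply: crit_degree.
- by apply/imageP; exists 0%R; rewrite // irr0 cfun11.
have [i [kLm nkL]] := exists_level p_pr n_ge3 oG clG m3.
by rewrite -(crit_degree m3 kLm nkL); apply: image_f.
Qed.

End Criterion.

(* A twist turns V into a group of class at most 2 with product x + y + coc x y,
   on which rot acts as an automorphism of order dividing 5. *)
Record twist (V : finZmodType) := Twist {
  rot : V -> V;
  coc : V -> V -> V;
  rotD : forall x y, rot (x + y) = rot x + rot y;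
  rot5 : forall x, iter 5 rot x = x;
  cocDl : forall x y z, coc (x + y) z = coc x z + coc y z;
  cocDr : forall x y z, coc x (y + z) = coc x y + coc x z;
  coc_rot : forall x y, coc (rot x) (rot y) = rot (coc x y);
  coc_cocl : forall x y z, coc (coc x y) z = 0;
  coc_cocr : forall x y z, coc x (coc y z) = 0 }.

(** An alias indexed by the twist, so that each twist puts its own group structure on the same
    set. *)
Definition tprod (V : finZmodType) of twist V := ('Z_5 * V)%type.

Section TwistedProduct.
Variables (V : finZmodType) (T : twist V).
Local Notation f := (rot T).
Local Notation C := (coc T).
Implicit Types (x y z : V) (a b c : 'Z_5).

Definition rotn a x := iter a f x.

Lemma rotnD a b x : rotn (a + b) x = rotn b (rotn a x).
Proof.
rewrite /rotn -iterD /= addnC.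
have mod5 k y : iter (k %% 5) f y = iter k f y.
  rewrite {2}(divn_eq k 5) addnC iterD; congr (iter _ _ _).
  by elim: (k %/ 5)%N => // d IHd; rewrite mulSn iterD rot5.
exact: mod5.
Qed.

Lemma rotn0 x : rotn 0 x = x. Proof. by []. Qed.

Lemma rotnN a x : rotn a (rotn (- a) x) = x.
Proof. by rewrite -rotnD addNr. Qed.

Lemma rotn_add a x y : rotn a (x + y) = rotn a x + rotn a y.
Proof. by rewrite /rotn; elim: (nat_of_ord a) => //= k ->; rewrite rotD. Qed.

Lemma rotn_coc a x y : rotn a (C x y) = C (rotn a x) (rotn a y).
Proof. by rewrite /rotn; elim: (nat_of_ord a) => //= k ->; rewrite coc_rot. Qed.

Local Notation gT := (tprod T).

HB.instance Definition _ := Finite.copy gT ('Z_5 * V)%type.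

(** The twisted group on [V], extended by ['Z_5] acting on the right through [rot]. *)
Definition tmul (u v : gT) : gT :=
  (u.1 + v.1, rotn v.1 u.2 + v.2 + C (rotn v.1 u.2) v.2).
Definition tinv (u : gT) : gT :=
  (- u.1, rotn (- u.1) (- u.2 + C u.2 u.2)).

Lemma coc0l x : C 0 x = 0.
Proof. by apply: (addrI (C 0 x)); rewrite -cocDl !addr0. Qed.
Lemma coc0r x : C x 0 = 0.
Proof. by apply: (addrI (C x 0)); rewrite -cocDr !addr0. Qed.
Lemma cocNl x y : C (- x) y = - C x y.
Proof. by apply: (addrI (C x y)); rewrite -cocDl !subrr coc0l. Qed.
Lemma cocNr x y : C x (- y) = - C x y.
Proof. by apply: (addrI (C x y)); rewrite -cocDr !subrr coc0r. Qed.

Lemma tmulA : associative tmul.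
Proof.
move=> u v w; congr (_, _); rewrite /= ?addrA //.
rewrite !rotn_add !rotn_coc -!rotnD !cocDl !cocDr !coc_cocl !coc_cocr !addr0.
by rewrite !addrA [RHS](ACl (1*2*4*6*3*5)).
Qed.

Lemma tmul1 : left_id ((0, 0) : gT) tmul.
Proof.
case=> a x; rewrite /tmul /= add0r; congr (_, _).
have -> : rotn a 0 = 0 by apply: (addrI (rotn a 0)); rewrite -rotn_add !addr0.
by rewrite coc0l add0r addr0.
Qed.

Lemma tmulV : left_inverse ((0, 0) : gT) tinv tmul.
Proof.
case=> a x; rewrite /tmul /tinv /= addNr rotnN; congr (_, _).
by rewrite cocDl cocNl coc_cocl addr0 addrAC addrK addNr.
Qed.

HB.instance Definition _ := Finite_isGroup.Build gT tmulA tmul1 tmulV.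

End TwistedProduct.

(** [n] strictly decreasing natural numbers starting below [n] can only be [n - 1], ..., 0. This
    yields the orders of the layers without counting their elements. *)
Lemma strict_chain n (a : nat -> nat) i : (a 1 < n)%N ->
  (forall k, (0 < k < n)%N -> (a k.+1 < a k)%N) -> (0 < i <= n)%N -> a i = (n - i)%N.
Proof.
move=> a1 aS /andP[i0 i_n]; apply/eqP; rewrite eqn_leq; apply/andP; split.
  elim: i i0 i_n => // [[_ _ | i IHi _ lt_in]]; first by move: a1; clear; lia.
  have := aS i.+1; rewrite lt_in => /(_ isT); have := IHi isT (ltnW lt_in).
  by move: lt_in; clear; lia.
suffices low d : forall k, (0 < k)%N -> (n - k)%N = d -> (d <= a k)%N by apply: low.
elim: d => // d IHd k k0 Dk; have lt_kn : (k < n)%N by rewrite -subn_gt0 Dk.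
have le_d : (d <= a k.+1)%N by apply: IHd; rewrite ?subnS ?Dk.
by apply: leq_ltn_trans le_d (aS k _); rewrite k0.
Qed.

(** * Twists of a group with eight layers, modelled on the powers of pi in O / 25 *)

Section FilteredTwist.
Variables (V : finZmodType) (T : twist V) (F : nat -> pred V) (w0 : V).
Local Notation f := (rot T).
Local Notation C := (coc T).
Local Notation gT := (tprod T).
(** [X] stands for multiplication by pi, and [D] is the commutator form of the twisted group. *)
Let X x := f x - x.
Let D x y := C x y - C y x.
Hypothesis cardV : #|{: V}| = (5 ^ 8)%N.
Hypothesis F0 : forall x, F 0 x.
Hypothesis FB : forall j x y, F j x -> F j y -> F j (x - y).
Hypothesis F_sub : forall j x, F j.+1 x -> F j x.
Hypothesis F8 : forall x, F 8 x -> x = 0.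
Hypothesis FX : forall j x, (j < 8)%N -> F j.+1 (X x) = F j x.
Hypothesis Fz : forall j, F j 0.
Hypothesis C6 : forall x y, F 6 (C x y).
Hypothesis C4l : forall x y, F 4 x -> C x y = 0.
Hypothesis C4r : forall x y, F 4 y -> C x y = 0.
Hypothesis Fw0 : ~~ F 1 w0.

Let F_leq i j x : (i <= j)%N -> F j x -> F i x.
Proof. by move/subnK<-; elim: (j - i)%N => // k IHk /F_sub/IHk. Qed.
Let FN j x : F j x -> F j (- x).
Proof. by move=> Fx; rewrite -sub0r FB. Qed.
Let FD j x y : F j x -> F j y -> F j (x + y).
Proof. by move=> Fx Fy; rewrite -[y]opprK FB // FN. Qed.
Let FDr j x y : F j y -> F j (x + y) = F j x.
Proof.
by move=> Fy; apply/idP/idP=> [Fxy | Fx]; [rewrite -(addrK y x) FB | rewrite FD].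
Qed.

Let wit j := iter j X w0.
Let wit_in j : (j < 8)%N -> F j (wit j).
Proof. by elim: j => // j IHj lt_j; rewrite /= FX ?IHj // ltnW. Qed.
Let wit_notin j : (j < 8)%N -> ~~ F j.+1 (wit j).
Proof. by elim: j => // j IHj lt_j; rewrite /= FX ?IHj // ltnW. Qed.

Let C_in j x y : F j x -> F j.+2 (C x y).
Proof.
move=> Fx; have [le_j | lt_j] := leqP j 4; first exact: F_leq (le_j : j.+2 <= 6)%N (C6 x y).
by rewrite C4l ?Fz // (F_leq (ltnW lt_j) Fx).
Qed.
Let C_inr j x y : F j y -> F j.+2 (C x y).
Proof.
move=> Fy; have [le_j | lt_j] := leqP j 4; first exact: F_leq (le_j : j.+2 <= 6)%N (C6 x y).
by rewrite C4r ?Fz // (F_leq (ltnW lt_j) Fy).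
Qed.
Let D_in j x y : F j x -> F j.+2 (D x y).
Proof. by move=> Fx; apply: FB; [apply: C_in | apply: C_inr]. Qed.

Lemma tprodM (g h : gT) :
  (g * h)%g = (g.1 + h.1, rotn T h.1 g.2 + h.2 + C (rotn T h.1 g.2) h.2) :> gT.
Proof. by []. Qed.

Lemma tprodV0 y : ((0, y) : gT)^-1%g = (0, - y + C y y).
Proof. by rewrite -[LHS]/(tinv ((0, y) : gT)) /tinv /= oppr0 rotn0. Qed.

Lemma tconj y (g : gT) : let u := rotn T g.1 y in
  (((0, y) : gT) ^ g)%g = (0, u + D u g.2) :> gT.
Proof.
move=> u; apply: (mulgI g); rewrite -conjgC !tprodM /= add0r addr0; congr (_, _).
rewrite rotn0 !cocDr cocNr !coc_cocr oppr0 !addr0 -/u.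
by rewrite !addrA subrK [x in x + _]addrC.
Qed.

Lemma tcomm y (g : gT) : let u := rotn T g.1 y in
  [~ ((0, y) : gT), g]%g = (0, (u - y) - C y (u - y) + D u g.2) :> gT.
Proof.
move=> u; rewrite commgEl tprodV0 tconj tprodM /= addr0; congr (_, _).
rewrite rotn0 -/u !(cocDl, cocDr, cocNl, cocNr) !coc_cocl !coc_cocr !oppr0 !addr0.
by rewrite subr0 opprB !addrA [RHS](ACl (2*3*1*5*6*4)).
Qed.

Let rot_diff j x : F j x -> F j.+1 (X x).
Proof.
move=> Fx; have [lt_j | le_j] := ltnP j 8; first by rewrite FX.
have f0 : f 0 = 0 by apply: (addrI (f 0)); rewrite -rotD !addr0.
by rewrite (F8 (F_leq le_j Fx)) /X f0 subr0.
Qed.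

Let iter_in j k x : F j x -> F j (iter k f x).
Proof.
move=> Fx; elim: k => //= k IHk.
by rewrite -[f _](subrK (iter k f x)) FD // F_sub // rot_diff.
Qed.

Let rotn_in j a x : F j x -> F j (rotn T a x). Proof. exact: iter_in. Qed.

(** The index is shifted because ['Z_5] accounts for the first factor 5: [tlayer i] has index
    [5 ^ i] and is the [i]-th lower central term for [i] from 2 to 9. *)
Definition tlayer i : {set gT} := [set g | (g.1 == 0) && F i.-1 g.2].

Lemma tlayerE i (g : gT) : (g \in tlayer i) = (g.1 == 0) && F i.-1 g.2.
Proof. by rewrite inE. Qed.

Lemma tlayer_group i : group_set (tlayer i).
Proof.
apply/group_setP; split=> [|g h]; first by rewrite inE eqxx Fz.
rewrite !inE tprodM /= => /andP[/eqP-> Fg] /andP[/eqP-> Fh]; rewrite addr0 eqxx rotn0 /=.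
by rewrite FD ?FD // F_sub // F_sub // C_in.
Qed.
Canonical tlayerG i := Group (tlayer_group i).

Lemma tlayer_normal i : (tlayer i <| [set: gT])%g.
Proof.
apply/andP; split; first exact: subsetT.
apply/subsetP=> g _; rewrite inE; apply/subsetP=> _ /imsetP[[a y] /[!tlayerE]/= /andP[/eqP-> Fy] ->].
by rewrite tconj /= FD ?rotn_in // F_sub // F_sub // D_in // rotn_in.
Qed.

Lemma card_tprod : #|[set: gT]| = (5 ^ 9)%N.
Proof. rewrite cardsT card_prod cardV card_ord (expnS 5 8). congr (_ * _)%N. Qed.

Lemma tlayer_proper i : (0 < i < 9)%N -> tlayer i.+1 \proper tlayer i.
Proof.
case: i => // i /= lt_i; apply/properP; split.
  by apply/subsetP=> g /[!inE] /andP[-> /F_sub].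
by exists (0, wit i); rewrite tlayerE /= ?wit_in ?wit_notin.
Qed.

Let pG : (5.-group [set: gT])%g. Proof. by rewrite /pgroup card_tprod pnatX. Qed.

Lemma card_tlayer i : (0 < i <= 9)%N -> #|tlayer i| = (5 ^ (9 - i))%N.
Proof.
move=> i9; have pL k : (5.-group (tlayer k))%g := pgroupS (subsetT _) pG.
pose a k := logn 5 #|tlayer k|.
have aS k : (0 < k < 9)%N -> (a k.+1 < a k)%N.
  by move=> k9; apply: (properG_ltn_log (G := tlayerG k)) (pL k) (tlayer_proper k9).
have a1 : (a 1 < 9)%N.
  have -> : 9%N = logn 5 #|[set: gT]| by rewrite card_tprod pfactorK.
  apply: (properG_ltn_log (G := [set: gT]%G)) pG _; rewrite properT; apply/eqP=> all.
  by have := in_setT ((1%R, 0) : gT); rewrite -all tlayerE.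
have -> : #|tlayer i| = (5 ^ a i)%N by apply: (card_pgroup (pL i)).
by congr (_ ^ _)%N; apply: strict_chain.
Qed.

(** The main term [X y] moves by exactly one layer, and every contribution of the cocycle by at
    least two. *)
Lemma comm_outer_layer j y x : F j y -> ~~ F j.+1 y -> (j < 7)%N ->
  exists2 z, [~ ((0, y) : gT), ((1%R, x) : gT)]%g = (0, z) & F j.+1 z && ~~ F j.+2 z.
Proof.
move=> Fy nFy lt_j; exists (X y - C y (X y) + D (f y) x); first by rewrite tcomm.
have Ff : F j (f y) := iter_in 1 Fy.
have d2 : F j.+2 (- C y (X y) + D (f y) x) by rewrite FD ?FN ?C_in ?D_in.
by rewrite -addrA (FDr _ (F_sub d2)) (FDr _ d2) rot_diff //= FX.
Qed.

Lemma tprod_nil_class : nil_class [set: gT]%g = 8.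
Proof.
apply/eqP; rewrite eqn_leq; apply/andP; split.
  by apply: leq_trans (nil_class_pgroup pG) _; rewrite card_tprod pfactorK.
rewrite ltnNge; apply/negP=> /(lcn_nil_classP _ (pgroup_nil pG)) L8.
have L k : (k < 8)%N -> exists2 y : V,
    ((0, y) : gT) \in 'L_k.+1([set: gT])%g & F k y && ~~ F k.+1 y.
  elim: k => [_ | k IHk lt_k]; first by exists w0; rewrite ?inE // F0.
  have [y yL /andP[Fy nFy]] := IHk (ltnW lt_k).
  have [z Dz Fz'] := comm_outer_layer 0 Fy nFy lt_k.
  by exists z => //; rewrite -Dz lcnSn mem_commg ?inE.
have [y yL /andP[_ ny]] := L 7 isT.
by move: yL; rewrite L8 inE => /eqP[y0]; rewrite y0 Fz in ny.
Qed.

Lemma tprod_maximal_class : maximal_class 5 [set: gT]%G.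
Proof. by split=> //; exists 9%N; split; [| exact: card_tprod | exact: tprod_nil_class]. Qed.

Lemma index_tlayer i : (0 < i <= 9)%N -> #|[set: gT] : tlayerG i|%g = (5 ^ i)%N.
Proof.
move=> i09; have /andP[_ i9] := i09.
rewrite -divgS ?subsetT // card_tprod (card_tlayer i09) -expnB; [|by []|exact: leq_subr].
by congr (_ ^ _)%N; apply: subKn.
Qed.

Lemma tlayer_lcn i : (1 < i <= 9)%N -> tlayer i = 'L_i([set: gT])%g.
Proof.
move=> /andP[i2 i9]; apply: (mc_normal_eq (isT : prime 5) (isT : 2 < 9)%N card_tprod tprod_nil_class) => //.
  exact: tlayer_normal.
have i0 : (0 < i <= 9)%N by rewrite (ltnW i2).
exact: index_tlayer.
Qed.

Lemma tcomm0 y x : [~ ((0, y) : gT), ((0, x) : gT)]%g = (0, D y x).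
Proof. by rewrite tcomm /= rotn0 subrr coc0r subr0 add0r. Qed.

Lemma fst_expg (g : gT) r : (g ^+ r)%g.1 = g.1 *+ r.
Proof. by elim: r => // r IHr; rewrite expgS tprodM /= IHr mulrS. Qed.

Lemma Z5_mulrn_eq1 (a : 'Z_5) : a != 0 -> exists r, a *+ r = 1.
Proof.
case: a => [[|[|[|[|[|//]]]]] lt_a] // _; [exists 1%N | exists 3 | exists 2 | exists 4];
  exact/val_inj.
Qed.

(** [5 ^ k m] is to be the degree of the characters with kernel [L m], induced from [tlayerG (k m)].
    By [kD_onto] the elements of [tlayerG 1] outside that subgroup move their linear
    constituents. *)
Variable k : nat -> nat.
Hypothesis k_bound : forall m, (2 < m <= 9)%N -> (0 < k m)%N && ((k m).+1 < m)%N.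
Hypothesis kD : forall m x y, (2 < m <= 9)%N ->
  F (k m).-1 x -> F (k m).-1 y -> F m.-1 (D x y).
Hypothesis kD_onto : forall m x, (2 < m <= 9)%N -> ~~ F (k m).-1 x ->
  exists2 y, F (k m).-1 y & F m.-2 (D y x) && ~~ F m.-1 (D y x).

Let derB m : (2 < m <= 9)%N -> ((tlayerG (k m))^`(1) \subset 'L_m([set: gT]))%g.
Proof.
move=> m3; rewrite -tlayer_lcn; last by case/andP: m3 => /ltnW->.
rewrite gen_subG; apply/subsetP=> _ /imset2P[[a x] [b y] /[!tlayerE] /= + + ->].
move=> /andP[/eqP-> Fx] /andP[/eqP-> Fy].
by rewrite tcomm0 /= kD.
Qed.

Let commB m (g : gT) : (2 < m <= 9)%N -> g \in [set: gT]%G -> g \notin tlayerG (k m) ->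
  exists h b, [/\ h \in <[g]>, b \in tlayerG (k m),
    [~ b, h] \in 'L_m.-1([set: gT]) & [~ b, h] \notin 'L_m([set: gT])]%g.
Proof.
move=> m39 _; have [/andP[k0 km] [m3 m9]] := (k_bound m39, andP m39).
rewrite -!tlayer_lcn ?(ltnW m3) //; last by case: m m3 m9 {m39 k0 km} => // m /ltnSE -> /ltnW.
rewrite tlayerE => ng; have [g0 | g0] := eqVneq g.1 0.
  rewrite g0 eqxx /= in ng; have [y Fy /andP[D1 D2]] := kD_onto m39 ng.
  have Dg : g = ((0, g.2) : gT) by rewrite -g0; case: (g).
  exists g, (0, y); split; rewrite ?cycle_id ?tlayerE //.
  - by rewrite Dg tcomm0.
  by rewrite Dg tcomm0.
(* A power of [g] has first component 1; its commutator with the witness of depth [m - 3] has depth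
   exactly [m - 2], hence lies in [L m.-1] but not in [L m]. *)
have [r r1] := Z5_mulrn_eq1 g0.
have Dh : (g ^+ r)%g = ((1%R, (g ^+ r)%g.2) : gT) by rewrite -r1 -fst_expg; case: (_ ^+ _)%g.
have j7 : (m - 3 < 7)%N by move: m3 m9; clear; lia.
have [z Dz /andP[z1 z2]] := comm_outer_layer (g ^+ r)%g.2 (wit_in (ltnW j7)) (wit_notin (ltnW j7)) j7.
exists (g ^+ r)%g, (0, wit (m - 3)); rewrite mem_cycle Dh Dz !tlayerE /=.
have -> : m.-2 = (m - 3).+1 by move: m3 m9; clear; lia.
have -> : m.-1 = (m - 3).+2 by move: m3 m9; clear; lia.
split=> //; apply: F_leq (wit_in (ltnW j7)); move: km; clear; lia.
Qed.

Lemma tprod_normally_monomial : normally_monomial [set: gT]%G.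
Proof.
apply: (crit_normally_monomial (isT : prime 5) (isT : 2 < 9)%N card_tprod tprod_nil_class _ derB commB).
by move=> m _; apply: tlayer_normal.
Qed.

Lemma tprod_cdP x : x \in cd [set: gT]%G <->
  x = 1 \/ exists2 m, (2 < m <= 9)%N & x = (5 ^+ k m).
Proof.
have iB m : (2 < m <= 9)%N -> #|[set: gT] : tlayerG (k m)|%g = (5 ^ k m)%N.
  move=> m39; have /andP[k0 km] := k_bound m39.
  have k9 : (0 < k m <= 9)%N by move: k0 km m39; clear; lia.
  exact: index_tlayer.
have P := crit_cdP (isT : prime 5) (isT : 2 < 9)%N card_tprod tprod_nil_class
  (fun m _ => tlayer_normal (k m)) derB commB x.
split=> [/P[] | h]; first by left.
  by case=> m m39 ->; right; exists m => //; rewrite (iB m m39) natrX.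
apply/P; case: h => [|[m m39 ->]]; first by left.
by right; exists m => //; rewrite (iB m m39) natrX.
Qed.

End FilteredTwist.

(** * The cocycles over Z[zeta] / 25 and the four examples *)

Section Z25Data.
Local Notation K := 'Z_25.
Definition Z25x4 := (K * K * K * K)%type.
HB.instance Definition _ := GRing.Zmodule.on Z25x4.
HB.instance Definition _ := Finite.on Z25x4.
Implicit Types x y z : Z25x4.

Definition q25 : K := 5.
Local Notation q := q25.

Lemma q25_sq : q * q = 0. Proof. exact/val_inj. Qed.

(* Multiplication by 1 + pi in the basis 1, pi, pi^2, pi^3 of Z[pi] / 25, where
   pi^4 = - 5 - 10 pi - 10 pi^2 - 5 pi^3, that is (1 + pi)^5 = 1. *)
Definition rot25 x : Z25x4 := let: (x0, x1, x2, x3) := x in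
  (x0 - q * x3, x1 + x0 - 2 * q * x3, x2 + x1 - 2 * q * x3, x3 + x2 - q * x3).

(* For any values of al, w and t these forms are equivariant under rot25. The degree
   5^2 is produced by t at level 9 or by al at level 8, the degree 5^3 by w at level 9. *)
Definition coc25 (al w t : K) x y : Z25x4 :=
  let: (x0, x1, x2, x3) := x in let: (y0, y1, y2, y3) := y in
  (0, 0, q * (al * (x0 * y1 - x1 * y0)),
   q * (t * (x0 * y1 - x1 * y0) + (al - w) * (x0 * y2 - x2 * y0)
        + w * (x1 * y2 - x2 * y1) - w * (x0 * y3 - x3 * y0))).

Lemma rot25D x y : rot25 (x + y) = rot25 x + rot25 y.
Proof.
case: x y => [[[x0 x1] x2] x3] [[[y0 y1] y2] y3].
by congr (_, _, _, _) => /=; ring.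
Qed.

Lemma rot25_5 x : iter 5 rot25 x = x.
Proof.
case: x => [[[x0 x1] x2] x3].
by congr (_, _, _, _) => /=; rewrite /q25; ring.
Qed.

Section Cocycle.
Variables al w t : K.
Local Notation C := (coc25 al w t).

Lemma coc25Dl x y z : C (x + y) z = C x z + C y z.
Proof.
case: x y z => [[[x0 x1] x2] x3] [[[y0 y1] y2] y3] [[[z0 z1] z2] z3].
by congr (_, _, _, _) => /=; ring.
Qed.

Lemma coc25Dr x y z : C x (y + z) = C x y + C x z.
Proof.
case: x y z => [[[x0 x1] x2] x3] [[[y0 y1] y2] y3] [[[z0 z1] z2] z3].
by congr (_, _, _, _) => /=; ring.
Qed.

Lemma coc25_rot x y : C (rot25 x) (rot25 y) = rot25 (C x y).
Proof.
case: x y => [[[x0 x1] x2] x3] [[[y0 y1] y2] y3].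
by congr (_, _, _, _) => /=; move: q25 q25_sq => q qq; ring: qq.
Qed.

Lemma coc25_cocl x y z : C (C x y) z = 0.
Proof.
case: x y z => [[[x0 x1] x2] x3] [[[y0 y1] y2] y3] [[[z0 z1] z2] z3].
by congr (_, _, _, _) => /=; move: q25 q25_sq => q qq; ring: qq.
Qed.

Lemma coc25_cocr x y z : C x (C y z) = 0.
Proof.
case: x y z => [[[x0 x1] x2] x3] [[[y0 y1] y2] y3] [[[z0 z1] z2] z3].
by congr (_, _, _, _) => /=; move: q25 q25_sq => q qq; ring: qq.
Qed.

Definition twist25 := Twist rot25D rot25_5 coc25Dl coc25Dr coc25_rot coc25_cocl coc25_cocr.

End Cocycle.

(* Membership in pi^j Z[pi] / 25 for j <= 8, since 5 is a unit times pi^4. *)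
Definition filt25 (j : nat) x : bool := let: (x0, x1, x2, x3) := x in
  [&& [&& (0 < j)%N ==> (q * x0 == 0), (1 < j)%N ==> (q * x1 == 0),
      (2 < j)%N ==> (q * x2 == 0) & (3 < j)%N ==> (q * x3 == 0)],
      (4 < j)%N ==> (x0 == 0), (5 < j)%N ==> (x1 == 0),
      (6 < j)%N ==> (x2 == 0) & (7 < j)%N ==> (x3 == 0)].

Lemma card_Z25x4 : #|{: Z25x4}| = (5 ^ 8)%N.
Proof.
have c : #|{: K}| = (5 ^ 2)%N by rewrite card_ord.
by rewrite !card_prod c -!expnD.
Qed.

Lemma filt25_0 x : filt25 0 x. Proof. by case: x => [[[x0 x1] x2] x3]. Qed.

Lemma filt25z j : filt25 j 0.
Proof. by rewrite /filt25 /= mulr0 eqxx !implybT. Qed.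

Lemma filt25B j x y : filt25 j x -> filt25 j y -> filt25 j (x - y).
Proof.
have B (c : bool) (a b : K) : c ==> (a == 0) -> c ==> (b == 0) -> c ==> (a - b == 0).
  by case: c => //= /eqP-> /eqP->; rewrite subr0.
case: x y => [[[x0 x1] x2] x3] [[[y0 y1] y2] y3].
move=> /and5P[/and4P[a b c d] e f g h] /and5P[/and4P[a' b' c' d'] e' f' g' h'].
by rewrite /filt25 /= !mulrBr !B.
Qed.

Lemma filt25_sub j x : filt25 j.+1 x -> filt25 j x.
Proof.
have I i (b : bool) : (i < j.+1)%N ==> b -> (i < j)%N ==> b.
  by move/implyP=> h; apply/implyP=> /leqW/h.
case: x => [[[x0 x1] x2] x3] /and5P[/and4P[a b c d] e f g h].
by rewrite /filt25 !I.
Qed.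

Lemma filt25_8 x : filt25 8 x -> x = 0.
Proof.
by case: x => [[[x0 x1] x2] x3] /and5P[_ /eqP-> /eqP-> /eqP-> /eqP->].
Qed.

Lemma filt25X j x : (j < 8)%N -> filt25 j.+1 (rot25 x - x) = filt25 j x.
Proof.
case: x => [[[x0 x1] x2] x3].
have -> : rot25 (x0, x1, x2, x3) - (x0, x1, x2, x3) =
  (- (q * x3), x0 - 2 * (q * x3), x1 - 2 * (q * x3), x2 - q * x3).
  by congr (_, _, _, _) => /=; ring.
have qq a : q * (q * a) = 0 by rewrite mulrA q25_sq mul0r.
have qz a b : q * (a - b * (q * x3)) = q * a.
  by rewrite mulrBr mulrCA qq mulr0 subr0.
have qz' a : q * (a - q * x3) = q * a by rewrite mulrBr qq subr0.
have [x3q | x3q] := eqVneq (q * x3) 0.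
  rewrite /filt25 x3q !mulr0 !subr0 oppr0 mulr0 eqxx.
  move: j => [|[|[|[|[|[|[|[|//]]]]]]]] _ /=; rewrite ?andbT //.
rewrite /filt25 qz qz' !mulrN qq oppr0 !qz eqxx.
by move: j => [|[|[|[|[|[|[|[|//]]]]]]]] _ /=; rewrite ?oppr_eq0 ?(negPf x3q) ?andbF ?andbT.
Qed.

Section CocycleFilt.
Variables al w t : K.
Local Notation C := (coc25 al w t).

Lemma filt25_coc x y : filt25 6 (C x y).
Proof.
case: x y => [[[x0 x1] x2] x3] [[[y0 y1] y2] y3].
by rewrite /filt25 /coc25 !(mulrA q) q25_sq !mul0r mulr0 !eqxx.
Qed.

Lemma coc25C x y : C y x = - C x y.
Proof.
case: x y => [[[x0 x1] x2] x3] [[[y0 y1] y2] y3].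
by congr (_, _, _, _) => /=; ring.
Qed.

Lemma coc25_filt x y : filt25 4 x -> C x y = 0.
Proof.
case: x y => [[[x0 x1] x2] x3] [[[y0 y1] y2] y3].
move=> /and5P[/and4P[/eqP e0 /eqP e1 /eqP e2 /eqP e3] _ _ _ _].
rewrite /coc25; congr (_, _, _, _).
  transitivity (al * (q * x0 * y1 - q * x1 * y0)); first by ring.
  by rewrite e0 e1 !mul0r subr0 mulr0.
transitivity (t * (q * x0 * y1 - q * x1 * y0) + (al - w) * (q * x0 * y2 - q * x2 * y0)
              + w * (q * x1 * y2 - q * x2 * y1) - w * (q * x0 * y3 - q * x3 * y0)).
  by ring.
by rewrite e0 e1 e2 e3 !mul0r !subr0 !mulr0 subr0 !addr0.
Qed.

Lemma coc25_filtr x y : filt25 4 y -> C x y = 0.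
Proof. by move=> Fy; rewrite coc25C coc25_filt ?oppr0. Qed.

Lemma filt25_dbl j x : filt25 j (x + x) = filt25 j x.
Proof.
have dbl (a : K) : (a + a == 0) = (a == 0).
  apply/eqP/eqP=> [a0 | ->]; last by rewrite addr0.
  (* 13 is the inverse of 2 modulo 25. *)
  have <- : 13 * (a + a) = a
    by rewrite -[a + a](mulr_natl a 2) mulrA (_ : 13 * 2 = 1) ?mul1r //; apply/val_inj.
  by rewrite a0 mulr0.
by case: x => [[[x0 x1] x2] x3]; rewrite /filt25 /= !mulrDr !dbl.
Qed.

Lemma filt25_comm j x y : filt25 j (C x y - C y x) = filt25 j (C x y).
Proof. by rewrite (coc25C x y) opprK filt25_dbl. Qed.

Variables a b : nat.
(** The cocycle has values in pi^6 O, which is [tlayer 7], so the maximal subgroup is abelian modulo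
    [L m] for [m] at most 7; the degree is 5 there. *)
Let k (m : nat) := (if m == 9 then a else if m == 8 then b else 1)%N.

Lemma twist25_cd (D : seq algC) : (0 < a < 8)%N -> (0 < b < 7)%N ->
  D =i [:: 1; 5; 5 ^+ b; 5 ^+ a] ->
  (forall x y, filt25 b.-1 x -> filt25 b.-1 y -> filt25 7 (C x y)) ->
  (forall x y, filt25 a.-1 x -> filt25 a.-1 y -> filt25 8 (C x y)) ->
  (forall x, ~~ filt25 b.-1 x -> exists2 y, filt25 b.-1 y & ~~ filt25 7 (C y x)) ->
  (forall x, ~~ filt25 a.-1 x ->
    exists2 y, filt25 a.-1 y & filt25 7 (C y x) && ~~ filt25 8 (C y x)) ->
  exists (gT : finGroupType) (G : {group gT}),
    [/\ maximal_class 5 G, normally_monomial G & cd G =i D].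
Proof.
move=> a8 b7 eqD C7 C8 onto7 onto8; pose T := twist25 al w t; exists (tprod T), [set: tprod T]%G.
have w1 : ~~ filt25 1 (1, 0, 0, 0) by [].
have k_bound m : (2 < m <= 9)%N -> (0 < k m)%N && ((k m).+1 < m)%N.
  rewrite /k; case: eqP => [-> _ | _]; first exact: a8.
  by case: eqP => [-> _ | _ /andP[]]; first exact: b7.
have kE (P : nat -> Prop) : P 9 -> P 8 -> (forall m, (2 < m < 8)%N -> P m) ->
    forall m, (2 < m <= 9)%N -> P m.
  move=> P9 P8 Pm m /andP[m3]; rewrite leq_eqVlt ltnS leq_eqVlt ltnS.
  by case/predU1P=> [-> | /predU1P[-> | lt_m8]] //; apply: Pm; rewrite m3.
have k1 m : (2 < m < 8)%N -> k m = 1%N.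
  by rewrite /k => /andP[_]; do 2?case: eqP => [-> //|_].
have kD m : (2 < m <= 9)%N -> forall x y,
    filt25 (k m).-1 x -> filt25 (k m).-1 y -> filt25 m.-1 (C x y - C y x).
  move: m; apply: kE => [x y | x y | m m8 x y _ _]; rewrite filt25_comm.
  - exact: C8.
  - exact: C7.
  have F_leq i j z : (i <= j)%N -> filt25 j z -> filt25 i z.
    by move/subnK<-; elim: (j - i)%N => // d IHd /filt25_sub/IHd.
  by apply: F_leq (filt25_coc x y); move: m8; clear; lia.
have konto m : (2 < m <= 9)%N -> forall x, ~~ filt25 (k m).-1 x ->
    exists2 y, filt25 (k m).-1 y &
      filt25 m.-2 (C y x - C x y) && ~~ filt25 m.-1 (C y x - C x y).
  move: m; apply: kE => [x /onto8[y] | x /onto7[y] | m m8 x]; last by rewrite k1 //= filt25_0.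
    by exists y; rewrite // !filt25_comm.
  by exists y; rewrite // !filt25_comm // filt25_coc.
split.
- exact: (tprod_maximal_class (T := T) card_Z25x4 filt25_0 filt25B filt25_sub filt25_8
    (@filt25X) filt25z filt25_coc coc25_filt coc25_filtr w1).
- exact: (tprod_normally_monomial (T := T) card_Z25x4 filt25_0 filt25B filt25_sub filt25_8
    (@filt25X) filt25z filt25_coc coc25_filt coc25_filtr w1 k_bound
    (fun m x y m39 => kD m m39 x y) (fun m x m39 => konto m m39 x)).
have cdP := (tprod_cdP (T := T) card_Z25x4 filt25_0 filt25B filt25_sub filt25_8
    (@filt25X) filt25z filt25_coc coc25_filt coc25_filtr w1 k_bound
    (fun m x y m39 => kD m m39 x y) (fun m x m39 => konto m m39 x)).
move=> x; rewrite eqD; apply/idP/idP=> [/cdP[-> | [m]] | ].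
- exact: mem_head.
- move: m; apply: kE => [->|->|m m8 ->].
  + by rewrite !in_cons eqxx !orbT.
  + by rewrite !in_cons eqxx !orbT.
  by rewrite k1 // expr1 !in_cons eqxx !orbT.
rewrite !inE => /or4P[] /eqP Dx; apply/cdP; rewrite Dx; [by left | | | ]; right.
- by exists 3.
- by exists 8.
by exists 9.
Qed.
End CocycleFilt.

(** The undeformed extension: its maximal subgroup O / 25 is abelian. *)
Lemma twist25_cd_5 : exists (gT : finGroupType) (G : {group gT}),
  [/\ maximal_class 5 G, normally_monomial G & cd G =i [:: 1; 5]].
Proof.
have C0 x y : coc25 0 0 0 x y = 0.
  case: x y => [[[x0 x1] x2] x3] [[[y0 y1] y2] y3].
  by congr (_, _, _, _) => /=; ring.
apply: (@twist25_cd 0 0 0 1 1 _ isT isT) => [x | x y _ _ | x y _ _ | x | x].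
- by rewrite !inE expr1; do 2!case: (x == _).
- by rewrite C0 filt25z.
- by rewrite C0 filt25z.
- by rewrite filt25_0.
by rewrite filt25_0.
Qed.

Lemma filt25_1E (x0 x1 x2 x3 : K) : filt25 1 (x0, x1, x2, x3) = (q * x0 == 0).
Proof. by rewrite /filt25 /= !andbT. Qed.

Lemma filt25_2E (x0 x1 x2 x3 : K) :
  filt25 2 (x0, x1, x2, x3) = (q * x0 == 0) && (q * x1 == 0).
Proof. by rewrite /filt25 /= !andbT. Qed.

Lemma filt25_7E (u v : K) : filt25 7 (0, 0, q * u, q * v) = (q * u == 0).
Proof. by rewrite /filt25 !mulr0 !(mulrA q) q25_sq !mul0r eqxx /= andbT. Qed.

Lemma filt25_8E (u v : K) : filt25 8 (0, 0, q * u, q * v) = (q * u == 0) && (q * v == 0).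
Proof. by rewrite /filt25 !mulr0 !(mulrA q) q25_sq !mul0r eqxx. Qed.

Lemma filt25_bracket (x0 x1 y0 y1 : K) : q * x0 = 0 -> q * y0 = 0 -> q * (x0 * y1 - x1 * y0) = 0.
Proof.
by move=> e e'; rewrite mulrBr mulrA e mul0r (mulrCA q) e' mulr0 subrr.
Qed.

Lemma filt25_1P x : filt25 1 x -> q * x.1.1.1 = 0.
Proof. by case: x => [[[x0 x1] x2] x3] /and5P[/and4P[/eqP]]. Qed.

Lemma filt25_coc2 al w t x y : filt25 2 x -> filt25 2 y -> coc25 al w t x y = 0.
Proof.
case: x y => [[[x0 x1] x2] x3] [[[y0 y1] y2] y3] /and5P[/and4P[/eqP e0 /eqP e1 _ _] _ _ _ _].
case/and5P=> /and4P[/eqP e0' /eqP e1' _ _] _ _ _ _.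
rewrite /coc25; congr (_, _, _, _).
  transitivity (al * (q * x0 * y1 - x1 * (q * y0))); first by ring.
  by rewrite e0 e0' mul0r mulr0 subrr mulr0.
transitivity (t * (q * x0 * y1 - x1 * (q * y0)) + (al - w) * (q * x0 * y2 - x2 * (q * y0))
              + w * (q * x1 * y2 - x2 * (q * y1)) - w * (q * x0 * y3 - x3 * (q * y0))).
  by ring.
by rewrite e0 e0' e1 e1' !mul0r !mulr0 !subr0 !mulr0 subr0 !addr0.
Qed.

(** With [t] alone the values lie in pi^7 O, so the maximal subgroup is abelian modulo [L 8]; the
    form pairs 1 with pi and vanishes on pi O. *)
Lemma twist25_cd_5_25 : exists (gT : finGroupType) (G : {group gT}),
  [/\ maximal_class 5 G, normally_monomial G & cd G =i [:: 1; 5; 5 ^+ 2]].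
Proof.
apply: (@twist25_cd 0 0 1 2 1 _ isT isT) => [x | x y _ _ | x y | x | x].
- by rewrite !inE expr1; do 3!case: (x == _).
- case: x y => [[[x0 x1] x2] x3] [[[y0 y1] y2] y3].
  by rewrite filt25_7E mul0r mulr0.
- case: x y => [[[x0 x1] x2] x3] [[[y0 y1] y2] y3] /filt25_1P e /filt25_1P e'.
  by rewrite filt25_8E !mul0r mul1r subrr !mul0r subr0 !addr0 filt25_bracket // mulr0 eqxx.
- by rewrite filt25_0.
case: x => [[[x0 x1] x2] x3]; rewrite filt25_1E => nx0.
(* The element pi, which pairs to [- q * x0] with [x]. *)
exists (0, 1, 0, 0) => //.
have -> : coc25 0 0 1 (0, 1, 0, 0) (x0, x1, x2, x3) = (0, 0, q * 0, q * (- x0)).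
  by rewrite /coc25; congr (_, _, q * _, q * _); ring.
by rewrite filt25_7E filt25_8E mulr0 eqxx mulrN oppr_eq0.
Qed.

(** Pairing with pi^3 detects the coordinate [x0] modulo 5; once that vanishes, pairing with pi^2
    detects [x1]. *)
Lemma coc25_onto al x : ~~ filt25 2 x ->
  exists2 y, filt25 2 y & filt25 7 (coc25 al 1 0 y x) && ~~ filt25 8 (coc25 al 1 0 y x).
Proof.
case: x => [[[x0 x1] x2] x3]; rewrite filt25_2E.
have [x0q /= nx1 | x0q _] := eqVneq (q * x0) 0.
  exists (0, 0, 1, 0) => //.
  have -> : coc25 al 1 0 (0, 0, 1, 0) (x0, x1, x2, x3) = (0, 0, q * 0, q * ((1 - al) * x0 - x1)).
    by rewrite /coc25; congr (_, _, _, q * _); ring.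
  by rewrite filt25_7E filt25_8E mulr0 eqxx mulrBr mulrCA x0q mulr0 sub0r oppr_eq0.
exists (0, 0, 0, 1) => //.
have -> : coc25 al 1 0 (0, 0, 0, 1) (x0, x1, x2, x3) = (0, 0, q * 0, q * x0).
  by rewrite /coc25; congr (_, _, _, q * _); ring.
by rewrite filt25_7E filt25_8E mulr0 eqxx.
Qed.

(** With [w] alone the values again lie in pi^7 O, but the largest layer on which the form vanishes
    is now pi^2 O, of index [5 ^ 3] in the group. *)
Lemma twist25_cd_5_125 : exists (gT : finGroupType) (G : {group gT}),
  [/\ maximal_class 5 G, normally_monomial G & cd G =i [:: 1; 5; 5 ^+ 3]].
Proof.
apply: (@twist25_cd 0 1 0 3 1 _ isT isT) => [x | x y _ _ | x y Fx Fy | x | x].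
- by rewrite !inE expr1; do 3!case: (x == _).
- case: x y => [[[x0 x1] x2] x3] [[[y0 y1] y2] y3].
  by rewrite filt25_7E mul0r mulr0.
- by rewrite filt25_coc2 ?filt25z.
- by rewrite filt25_0.
exact: coc25_onto.
Qed.

(** Adding [al] gives a component in pi^6 O pairing 1 with pi, which raises the degree at kernel
    [L 8] to [5 ^ 2]. *)
Lemma twist25_cd_5_25_125 : exists (gT : finGroupType) (G : {group gT}),
  [/\ maximal_class 5 G, normally_monomial G & cd G =i [:: 1; 5; 5 ^+ 2; 5 ^+ 3]].
Proof.
apply: (@twist25_cd 1 1 0 3 2 _ isT isT) => [x | x y | x y Fx Fy | x | x].
- by [].
- case: x y => [[[x0 x1] x2] x3] [[[y0 y1] y2] y3] /filt25_1P e /filt25_1P e'.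
  by rewrite filt25_7E mul1r filt25_bracket.
- by rewrite filt25_coc2 ?filt25z.
- case: x => [[[x0 x1] x2] x3]; rewrite filt25_1E => nx0.
  exists (0, 1, 0, 0) => //.
  have -> : coc25 1 1 0 (0, 1, 0, 0) (x0, x1, x2, x3) = (0, 0, q * - x0, q * x2).
    by rewrite /coc25; congr (_, _, q * _, q * _); ring.
  by rewrite filt25_7E mulrN oppr_eq0.
exact: coc25_onto.
Qed.

End Z25Data.

Theorem theoremA :
  let degree_sets : seq (seq algC) :=
    [:: [:: 1; 5]; [:: 1; 5; 5 ^+ 2]; [:: 1; 5; 5 ^+ 3];
        [:: 1; 5; 5 ^+ 2; 5 ^+ 3]] in
  (forall (gT : finGroupType) (G : {group gT}),
     maximal_class 5 G -> normally_monomial G ->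
     exists2 D : seq algC, D \in degree_sets & cd G =i D) /\
  (forall D : seq algC, D \in degree_sets ->
     exists (gT : finGroupType) (G : {group gT}),
       [/\ maximal_class 5 G, normally_monomial G & cd G =i D]).
Proof.
split=> [gT G | D]; first exact: nm5_cd.
rewrite !inE => /or4P[] /eqP->.
- exact: twist25_cd_5.
- exact: twist25_cd_5_25.
- exact: twist25_cd_5_125.
exact: twist25_cd_5_25_125.
Qed.
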